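(* Let $T>0$, $d\in\mathbb{N}$, and let $\mathcal{X}$ be the set of continuous piecewise linear paths $[0,T]\to\mathbb{R}^d$. For $X,Y\in\mathcal{X}$ and $s,t\in[0,T]$ set $$U(s,t) = k\big(X|_{[0,s]},\,Y|_{[0,t]}\big),\qquad \widetilde U(s,t) = k\big(\overleftarrow{X}|_{[0,s]},\,\overleftarrow{Y}|_{[0,t]}\big),$$ where $\overleftarrow{X}_r = X_{T-r}$ and $\overleftarrow{Y}_r=Y_{T-r}$ for $r\in[0,T]$ are the paths reversed in time. Then for every $\gamma\in\mathcal{X}$ the directional derivative of the signature kernel along $\gamma$ satisfies $$k_\gamma(X,Y) = \int_0^{T}\int_0^{T} U(s,t)\,\widetilde U(T-s,T-t)\,\big(\dot{\gamma}_s^{T}\dot{Y}_t\big)\,ds\,dt .$$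
   Context: For a continuous path $Z:[a,b]\to\mathbb{R}^d$ of bounded variation with coordinates $Z=(Z^{(1)},\dots,Z^{(d)})$, and a multi-index (word) $\boldsymbol\alpha=(\alpha_1,\dots,\alpha_j)$ with $\alpha_i\in\{1,\dots,d\}$, the signature coordinate is the iterated integral $S(Z)^{\boldsymbol\alpha}=\int_{a<s_1<\dots<s_j<b} dZ^{(\alpha_1)}_{s_1}\cdots dZ^{(\alpha_j)}_{s_j}$, with $S(Z)^{\emptyset}=1$ for the empty word ($j=0$). The signature kernel of two such paths $Z,W$ is $k(Z,W)=\sum_{j=0}^\infty\sum_{|\boldsymbol\alpha|=j} S(Z)^{\boldsymbol\alpha}S(W)^{\boldsymbol\alpha}$ (the inner sum over all words of length $j$). For a path restricted to $[0,s]$ the signature is taken over $[0,s]$. The directional derivative of $k$ along a path $\gamma$ is $k_\gamma(X,Y)=\frac{\partial}{\partial\epsilon}k(X+\epsilon\gamma,Y)\big|_{\epsilon=0}$. Dots denote time derivatives (defined almost everywhere for piecewise linear paths). *)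

(* Defs.v *)
From Stdlib Require Import Reals Lra List.
From Coquelicot Require Import Coquelicot.
Open Scope R_scope.

(* A path in R^d is a function R -> (nat -> R); coordinate i (for i < d) is
   Z r i.  Coordinates i >= d are ignored by every definition below. *)
Definition path := R -> nat -> R.

(* Continuous piecewise linear paths [0,T] -> R^d: there is a partition
   0 = p 0 < p 1 < ... < p n = T such that on every closed piece
   [p k, p (k+1)] each coordinate is affine (hence the path is continuous). *)
Definition piecewise_linear (T : R) (d : nat) (X : path) : Prop :=
  exists (n : nat) (p : nat -> R),
    p 0%nat = 0 /\ p n = T /\
    (forall k, (k < n)%nat -> p k < p (S k)) /\
    (forall k, (k < n)%nat -> forall i, (i < d)%nat ->
       exists a b : R, forall r, p k <= r <= p (S k) -> X r i = a + b * r).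

(* Time derivative of coordinate i (defined a.e. for piecewise linear paths). *)
Definition dot (Z : path) (i : nat) (u : R) : R := Derive (fun r => Z r i) u.

(* Iterated integral over [a,t] indexed by the REVERSED word:
   sig_rev Z a [a_j; ...; a_1] t
     = int_{a<s_1<...<s_j<t} dZ^{a_1}_{s_1} ... dZ^{a_j}_{s_j},
   using dZ_u = Zdot_u du (valid for piecewise linear paths). *)
Fixpoint sig_rev (Z : path) (a : R) (rw : list nat) (t : R) : R :=
  match rw with
  | nil => 1
  | i :: rw' => RInt (fun u => sig_rev Z a rw' u * dot Z i u) a t
  end.

Definition sig (Z : path) (a b : R) (alpha : list nat) : R :=
  sig_rev Z a (rev alpha) b.

Fixpoint words (d j : nat) : list (list nat) :=
  match j with
  | O => nil :: nil
  | S j' => flat_map (fun w => map (fun i => i :: w) (List.seq 0 d)) (words d j')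
  end.

Definition sum_list (l : list R) : R := fold_right Rplus 0 l.

Definition sigker (d : nat) (Z : path) (a b : R) (W : path) (c e : R) : R :=
  Series (fun j => sum_list (map (fun w => sig Z a b w * sig W c e w) (words d j))).

Definition rev_path (T : R) (Z : path) : path := fun r => Z (T - r).

Definition inner (d : nat) (x y : nat -> R) : R :=
  sum_list (map (fun i => x i * y i) (List.seq 0 d)).

(* Main.v *)
Require Import Defs.
From Stdlib Require Import Reals Lra Lia List Factorial.
From Coquelicot Require Import Coquelicot.
Open Scope R_scope.

(* Write x, y, g for the velocities of X, Y, gamma, and S(X)_{s,t} for the
   signature of X on [s,t].  Expanding the signature of X + e gamma to first
   order in e, the kernel has derivative sum_w D_w S(Y)^w_{0,T}, where D_w sums
   int S(X)^u_{0,s} g_i(s) S(X)^v_{s,T} ds over the factorisations w = u i v.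
   For each such factorisation also
   S(Y)^w_{0,T} = int S(Y)^u_{0,t} y_i(t) S(Y)^v_{t,T} dt.  Both identities
   follow by integrating by parts one letter at a time.  Multiplying them and
   summing over u, i, v gives the double integral of
   (sum_u S(X)^u_{0,s} S(Y)^u_{0,t}) (sum_v S(X)^v_{s,T} S(Y)^v_{t,T}) <g(s), y(t)>.
   Reversing time turns S^v_{s,T} into (-1)^|v| times the coordinate of the
   reversed word, and these signs cancel in the product, so the second factor is
   the kernel of the reversed paths.  The factorial decay of signatures justifies
   termwise differentiation and integration. *)

(** * Piecewise continuous functions *)

(** The list need not be sorted and may contain points outside the interval, so the breakpoints of
    several paths are merged by concatenating lists. *)
Definition free (L : list R) (a b : R) : Prop := forall x, In x L -> ~ (a < x < b).

Lemma free_incl (L L' : list R) (a b : R) : incl L L' -> free L' a b -> free L a b.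
Proof. intros H F x Hx; apply F, H, Hx. Qed.

(** Induction over the breakpoints in any order: an interval avoiding the tail of the list is cut at
    the head whenever the head lies inside it, and both pieces then avoid the whole list. *)
Lemma free_cut_ind (L : list R) (P : R -> R -> Prop) :
  (forall a b, a < b -> free L a b -> P a b) ->
  (forall a m b, a < m -> m < b -> P a m -> P m b -> P a b) ->
  forall a b, a < b -> P a b.
Proof.
  intros Hbase Hcut; revert Hbase; induction L as [|x L IH]; intros Hbase.
  - intros a b Hab; apply Hbase; auto; intros x [].
  - apply IH; intros a b Hab F.
    assert (G : forall u v, u < v -> a <= u -> v <= b -> (v <= x \/ x <= u) -> P u v).
    { intros u v Huv Hu Hv Hx; apply Hbase; auto; intros y [<-|Hy] Hyuv; [lra|].
      apply (F y Hy); lra. }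
    destruct (Rlt_dec a x) as [Hax|Hax]; [destruct (Rlt_dec x b) as [Hxb|Hxb]|].
    + apply Hcut with x; auto; apply G; lra.
    + apply G; lra.
    + apply G; lra.
Qed.

(** Asking for a continuous [h] on the whole line gives [f] one-sided limits at the ends of each
    free interval. The values of [f] at the breakpoints are left arbitrary. *)
Definition pw_cont (L : list R) (f : R -> R) : Prop :=
  forall a b, a < b -> free L a b ->
    exists h, (forall s, continuous h s) /\ forall s, a < s < b -> f s = h s.

Lemma pw_cont_incl (L L' : list R) (f : R -> R) : incl L L' -> pw_cont L f -> pw_cont L' f.
Proof. intros HL Hf a b Hab F; apply Hf; auto; now apply (free_incl L L'). Qed.

Lemma pw_cont_continuous (L : list R) (f : R -> R) : (forall s, continuous f s) -> pw_cont L f.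
Proof. intros Hf a b _ _; exists f; auto. Qed.

Lemma pw_cont_plus (L : list R) (f g : R -> R) :
  pw_cont L f -> pw_cont L g -> pw_cont L (fun s => f s + g s).
Proof.
  intros Hf Hg a b Hab F.
  destruct (Hf a b Hab F) as (h & Ch & Eh); destruct (Hg a b Hab F) as (k & Ck & Ek).
  exists (fun s => h s + k s); split.
  - intros s; apply (continuous_plus h k); auto.
  - intros s Hs; rewrite Eh, Ek; auto.
Qed.

Lemma pw_cont_mult (L : list R) (f g : R -> R) :
  pw_cont L f -> pw_cont L g -> pw_cont L (fun s => f s * g s).
Proof.
  intros Hf Hg a b Hab F.
  destruct (Hf a b Hab F) as (h & Ch & Eh); destruct (Hg a b Hab F) as (k & Ck & Ek).
  exists (fun s => h s * k s); split.
  - intros s; apply (continuous_mult h k); auto.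
  - intros s Hs; rewrite Eh, Ek; auto.
Qed.

Lemma pw_cont_opp (L : list R) (f : R -> R) : pw_cont L f -> pw_cont L (fun s => - f s).
Proof.
  intros Hf a b Hab F; destruct (Hf a b Hab F) as (h & Ch & Eh).
  exists (fun s => - h s); split.
  - intros s; apply (continuous_opp h); auto.
  - intros s Hs; rewrite Eh; auto.
Qed.

Lemma ex_RInt_pw_cont (L : list R) (f : R -> R) (a b : R) : pw_cont L f -> ex_RInt f a b.
Proof.
  intros Hf.
  assert (H : forall u v, u < v -> ex_RInt f u v).
  { apply (free_cut_ind L).
    - intros u v Huv F; destruct (Hf u v Huv F) as (h & Ch & Eh).
      apply (ex_RInt_ext h).
      + intros s; rewrite Rmin_left, Rmax_right by lra; intros Hs; symmetry; auto.
      + apply (ex_RInt_continuous h); auto.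
    - intros u m v _ _; apply ex_RInt_Chasles. }
  destruct (Rtotal_order a b) as [Hab|[<-|Hab]]; auto.
  - apply ex_RInt_point.
  - apply ex_RInt_swap; auto.
Qed.

Lemma is_RInt_pw_cont (L : list R) (f : R -> R) (a b : R) :
  pw_cont L f -> is_RInt f a b (RInt f a b).
Proof. intros Hf; apply (RInt_correct f), (ex_RInt_pw_cont L); auto. Qed.

(** Integrals ignore the finitely many points of [L]. This lets the pointwise derivative of a path,
    uncontrolled at kinks, be exchanged for a piecewise continuous velocity; integrability of [f] is
    derived from that of [g]. *)
Lemma RInt_free_ext (L : list R) (f g : R -> R) (a b : R) :
  a <= b -> pw_cont L g ->
  (forall s, a < s < b -> ~ In s L -> f s = g s) -> RInt f a b = RInt g a b.
Proof.
  intros Hab Hg E; apply (is_RInt_unique (V := R_CompleteNormedModule)).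
  assert (H : forall u v, u < v -> a <= u -> v <= b -> is_RInt f u v (RInt g u v)).
  { apply (free_cut_ind L (fun u v => a <= u -> v <= b -> is_RInt f u v (RInt g u v))).
    - intros u v Huv F Hu Hv; apply (is_RInt_ext g); [|now apply (is_RInt_pw_cont L)].
      intros s; rewrite Rmin_left, Rmax_right by lra; intros Hs; symmetry; apply E; [lra|].
      intros HL; exact (F s HL Hs).
    - intros u m v Hum Hmv H1 H2 Hu Hv.
      rewrite <- (RInt_Chasles g u m v) by now apply (ex_RInt_pw_cont L).
      apply (is_RInt_Chasles (V := R_NormedModule) f u m v); [apply H1|apply H2]; lra. }
  destruct (Req_dec a b) as [<-|Hn].
  - rewrite RInt_point; apply (is_RInt_point (V := R_NormedModule)).
  - apply H; lra.
Qed.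

Lemma continuous_RInt_pw_cont (L : list R) (f : R -> R) (a s : R) :
  pw_cont L f -> continuous (fun u => RInt f a u) s.
Proof.
  intros Hf; apply (continuous_RInt_1 f a s).
  apply filter_forall; intros z; now apply (is_RInt_pw_cont L).
Qed.

(** [F] and [G] are primitives only in the integrated sense, since they may fail to be
    differentiable at breakpoints. On a free interval the classical formula applies to C^1 versions
    of them, and the boundary terms telescope when intervals are glued. *)
Lemma RInt_by_parts (L : list R) (f g F G : R -> R) (a b : R) :
  pw_cont L f -> pw_cont L g ->
  (forall u v, is_RInt f u v (F v - F u)) -> (forall u v, is_RInt g u v (G v - G u)) ->
  a < b -> is_RInt (fun s => f s * G s + F s * g s) a b (F b * G b - F a * G a).
Proof.
  intros Hf Hg HF HG; revert a b; apply (free_cut_ind L).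
  - intros a b Hab Fr.
    destruct (Hf a b Hab Fr) as (h & Ch & Eh); destruct (Hg a b Hab Fr) as (k & Ck & Ek).
    assert (P : forall (f h F : R -> R), (forall s, a < s < b -> f s = h s) ->
      (forall s, continuous h s) ->
      (forall u v, is_RInt f u v (F v - F u)) ->
      (forall s, is_derive (fun z => F a + RInt h a z) s (h s)) /\
      forall s, a <= s <= b -> F s = F a + RInt h a s).
    { clear; intros f h F Eh Ch HF; split.
      - intros s; apply (is_derive_ext (fun z => plus (F a) (RInt h a z))); [reflexivity|].
        replace (h s) with (plus 0 (h s)) by (apply Rplus_0_l).
        apply (is_derive_plus (fun _ => F a) (fun z => RInt h a z)).
        + apply (is_derive_const (V := R_NormedModule)).
        + apply (is_derive_RInt h _ a); [|apply Ch].
          apply filter_forall; intros z; apply (RInt_correct h).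
          apply (ex_RInt_continuous h); auto.
      - intros s Hs.
        rewrite <- (RInt_ext f h); [rewrite (is_RInt_unique _ _ _ _ (HF a s)); lra|].
        intros z; rewrite Rmin_left, Rmax_right by lra; intros Hz; apply Eh; lra. }
    destruct (P f h F Eh Ch HF) as [DF EF]; destruct (P g k G Ek Ck HG) as [DG EG]; clear P.
    (* These are differentiable everywhere and agree with [F] and [G] on [a,b], end points
       included. *)
    pose (F' := fun z => F a + RInt h a z); pose (G' := fun z => G a + RInt k a z).
    assert (E : F b * G b - F a * G a = F' b * G' b - F' a * G' a).
    { unfold F', G'; rewrite <- !EF, <- !EG by lra; reflexivity. }
    rewrite E; clear E.
    apply (is_RInt_ext (fun s => h s * G' s + F' s * k s)).
    { intros s; rewrite Rmin_left, Rmax_right by lra; intros Hs.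
      now rewrite (Eh s), (Ek s), (EF s), (EG s) by lra. }
    apply (is_RInt_derive (fun s => F' s * G' s) (fun s => h s * G' s + F' s * k s)).
    + intros s _; apply (is_derive_mult F' G' s); [apply DF|apply DG|intros; apply Rmult_comm].
    + intros s _.
      assert (CF : continuous F' s) by (apply (ex_derive_continuous F'); eexists; apply DF).
      assert (CG : continuous G' s) by (apply (ex_derive_continuous G'); eexists; apply DG).
      apply (continuous_plus (fun s => h s * G' s) (fun s => F' s * k s)).
      * apply (continuous_mult h G'); auto.
      * apply (continuous_mult F' k); auto.
  - intros a m b _ _ H1 H2.
    replace (F b * G b - F a * G a) with (plus (F m * G m - F a * G a) (F b * G b - F m * G m))
      by (unfold plus; simpl; ring).
    apply (is_RInt_Chasles (V := R_NormedModule) _ a m b); assumption.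
Qed.

(** The induction step of every factorial bound below. The exponent of [M] is already raised in the
    hypothesis because the integrand carries the velocity of the new letter; [C] will be 1, |e| or
    e^2. *)
Lemma RInt_power_le (f : R -> R) (C M s : R) (n : nat) :
  0 <= s -> ex_RInt f 0 s ->
  (forall u, 0 <= u <= s -> Rabs (f u) <= C * M ^ S n * u ^ n / INR (fact n)) ->
  Rabs (RInt f 0 s) <= C * M ^ S n * s ^ S n / INR (fact (S n)).
Proof.
  intros Hs Hf Hb.
  assert (Hn : forall k, INR (fact k) <> 0) by (intros; apply INR_fact_neq_0).
  apply (norm_RInt_le f (fun u => C * M ^ S n * u ^ n / INR (fact n)) 0 s); auto.
  - apply (RInt_correct f); auto.
  - replace (C * M ^ S n * s ^ S n / INR (fact (S n))) with
      (minus (C * M ^ S n * s ^ S n / INR (fact (S n))) (C * M ^ S n * 0 ^ S n / INR (fact (S n)))).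
    2:{ unfold minus, plus, opp; simpl pow; simpl; field.
        pose proof (Hn (S n)) as H; simpl in H; exact H. }
    apply (is_RInt_derive (fun u => C * M ^ S n * u ^ S n / INR (fact (S n)))).
    + intros u _; auto_derive; auto.
      change (match n with O => 1 | S _ => INR n + 1 end) with (INR (S n)).
      change (fact n + n * fact n)%nat with (S n * fact n)%nat; rewrite mult_INR.
      simpl pow; field; split; [apply Hn|apply not_0_INR; discriminate].
    + intros u _; apply (ex_derive_continuous (V := R_NormedModule)); auto_derive; auto.
Qed.

(** The Weierstrass M-test makes the partial sums converge uniformly, and uniform limits commute
    with the integral. *)
Lemma is_RInt_Series (f : nat -> R -> R) (m v : nat -> R) (a b : R) :
  a <= b -> (forall n, is_RInt (f n) a b (v n)) ->
  (forall n s, a <= s <= b -> Rabs (f n s) <= m n) -> ex_series m ->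
  is_RInt (fun s => Series (fun n => f n s)) a b (Series v).
Proof.
  intros Hab Hf Hm Hs.
  (* [filterlim_RInt] asks for uniform convergence on the whole line, while the bound holds only on
     [a,b]; hence the cut-off. *)
  pose (chi := fun s => if Rle_dec a s then if Rle_dec s b then 1 else 0 else 0).
  assert (Echi : forall s, a <= s <= b -> chi s = 1).
  { intros s Hs'; unfold chi; destruct (Rle_dec a s); [destruct (Rle_dec s b)|]; lra. }
  pose (f' := fun n s => chi s * f n s).
  assert (Hm' : forall n s, Rabs (f' n s) <= m n).
  { intros n s.
    assert (Hm0 : 0 <= m n).
    { apply Rle_trans with (Rabs (f n a)); [apply Rabs_pos|apply Hm; lra]. }
    unfold f', chi; destruct (Rle_dec a s); [destruct (Rle_dec s b)|];
      rewrite ?Rmult_0_l, ?Rmult_1_l, ?Rabs_R0; auto. }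
  assert (Hi : forall n, is_RInt (f' n) a b (v n)).
  { intros n; apply (is_RInt_ext (f n)); auto.
    intros s; rewrite Rmin_left, Rmax_right by lra; intros Hs'.
    unfold f'; rewrite Echi by lra; now rewrite Rmult_1_l. }
  assert (Hex : forall s, ex_series (fun n => f' n s)).
  { intros s; apply (ex_series_le (fun n => f' n s) m); auto; intros n; apply Hm'. }
  destruct (filterlim_RInt (fun n s => sum_n (fun k => f' k s) n) a b eventually _
    (fun s => Series (fun n => f' n s)) (sum_n v)) as (If & H1 & H2).
  - intros n; induction n as [|n IH].
    + apply (is_RInt_ext (f' O)); [intros; now rewrite sum_O|rewrite sum_O; auto].
    + rewrite sum_Sn; apply (is_RInt_ext (fun s => plus (sum_n (fun k => f' k s) n) (f' (S n) s))).
      * intros; now rewrite sum_Sn.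
      * apply (is_RInt_plus (V := R_NormedModule)); auto.
  (* The tail of [m] dominates the tail of the function series at all [s] at once. *)
  - apply filterlim_locally; intros eps.
    destruct (proj1 (filterlim_locally (sum_n m) (Series m)) (Series_correct m Hs) eps) as (N & HN).
    exists N; intros n Hn s.
    apply (@norm_compat1 R_AbsRing R_NormedModule).
    specialize (HN n Hn).
    change (Rabs (sum_n (fun k => f' k s) n - Series (fun k => f' k s)) < eps).
    assert (HN' : Rabs (sum_n m n - Series m) < eps) by exact HN.
    rewrite (Series_incr_n m (S n)) in HN' by (auto; lia).
    rewrite (Series_incr_n (fun k => f' k s) (S n)) by (auto; lia).
    simpl pred in *; rewrite <- !sum_n_Reals in *.
    apply Rle_lt_trans with (Series (fun k => m (S n + k)%nat)).
    + match goal with |- Rabs (?u - (?u' + ?w)) <= _ =>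
        replace (u - (u' + w)) with (- w) by (change u' with u; ring) end.
      rewrite Rabs_Ropp; apply Rle_trans with (Series (fun k => Rabs (f' (S n + k)%nat s))).
      * apply Series_Rabs.
        apply (ex_series_le (V := R_CompleteNormedModule) (fun k => Rabs (f' (S n + k)%nat s))
          (fun k => m (S n + k)%nat)).
        -- intros k; unfold norm; simpl; unfold abs; simpl; rewrite Rabs_Rabsolu; apply Hm'.
        -- now apply (ex_series_incr_n m (S n)).
      * apply Series_le; [intros k; split; [apply Rabs_pos|apply Hm']|].
        now apply (ex_series_incr_n m (S n)).
    + apply Rle_lt_trans with (2 := HN').
      match goal with |- ?w <= Rabs (?u - (?u' + ?w')) =>
        replace (u - (u' + w')) with (- w) by (change u' with u; change w' with w; ring) end.
      rewrite Rabs_Ropp; apply Rle_abs.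
  - rewrite (is_series_unique v If H1).
    apply (is_RInt_ext (fun s => Series (fun n => f' n s))); auto.
    intros s; rewrite Rmin_left, Rmax_right by lra; intros Hs'.
    apply Series_ext; intros n; unfold f'; rewrite Echi by lra; apply Rmult_1_l.
Qed.

(** * Sums over words *)

Definition lsum {A : Type} (f : A -> R) (l : list A) : R := sum_list (map f l).

Lemma lsum_ext {A : Type} (f g : A -> R) (l : list A) :
  (forall x, In x l -> f x = g x) -> lsum f l = lsum g l.
Proof. intros H; unfold lsum; f_equal; now apply map_ext_in. Qed.

Lemma lsum_cons {A : Type} (f : A -> R) (x : A) (l : list A) : lsum f (x :: l) = f x + lsum f l.
Proof. reflexivity. Qed.

Lemma lsum_app {A : Type} (f : A -> R) (l l' : list A) : lsum f (l ++ l') = lsum f l + lsum f l'.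
Proof.
  induction l as [|x l IH]; simpl; rewrite ?lsum_cons, ?IH; [unfold lsum at 2; simpl|]; ring.
Qed.

Lemma lsum_map {A B : Type} (h : A -> B) (f : B -> R) (l : list A) :
  lsum f (map h l) = lsum (fun x => f (h x)) l.
Proof. unfold lsum; now rewrite map_map. Qed.

Lemma lsum_flat_map {A B : Type} (h : A -> list B) (f : B -> R) (l : list A) :
  lsum f (flat_map h l) = lsum (fun x => lsum f (h x)) l.
Proof.
  induction l as [|x l IH]; [reflexivity|]; simpl; now rewrite lsum_app, lsum_cons, IH.
Qed.

Lemma lsum_plus {A : Type} (f g : A -> R) (l : list A) :
  lsum (fun x => f x + g x) l = lsum f l + lsum g l.
Proof.
  induction l as [|x l IH]; [unfold lsum; simpl; ring|]; rewrite !lsum_cons, IH; ring.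
Qed.

Lemma lsum_0 {A : Type} (l : list A) : lsum (fun _ => 0) l = 0.
Proof. induction l as [|x l IH]; [reflexivity|]; rewrite lsum_cons, IH; ring. Qed.

Lemma lsum_mult_l {A : Type} (c : R) (f : A -> R) (l : list A) :
  lsum (fun x => c * f x) l = c * lsum f l.
Proof.
  induction l as [|x l IH]; [unfold lsum; simpl; ring|]; rewrite !lsum_cons, IH; ring.
Qed.

Lemma lsum_mult_r {A : Type} (c : R) (f : A -> R) (l : list A) :
  lsum (fun x => f x * c) l = lsum f l * c.
Proof.
  rewrite Rmult_comm, <- lsum_mult_l; apply lsum_ext; intros; apply Rmult_comm.
Qed.

Lemma lsum_minus {A : Type} (f g : A -> R) (l : list A) :
  lsum (fun x => f x - g x) l = lsum f l - lsum g l.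
Proof.
  induction l as [|x l IH]; [unfold lsum; simpl; ring|]; rewrite !lsum_cons, IH; ring.
Qed.

Lemma lsum_mult {A B : Type} (f : A -> R) (g : B -> R) (l : list A) (l' : list B) :
  lsum f l * lsum g l' = lsum (fun x => lsum (fun y => f x * g y) l') l.
Proof.
  rewrite <- lsum_mult_r; apply lsum_ext; intros; now rewrite lsum_mult_l.
Qed.

Lemma lsum_swap {A B : Type} (f : A -> B -> R) (l : list A) (l' : list B) :
  lsum (fun x => lsum (f x) l') l = lsum (fun y => lsum (fun x => f x y) l) l'.
Proof.
  induction l as [|x l IH].
  - unfold lsum at 1; simpl; symmetry; apply lsum_0.
  - rewrite lsum_cons, IH, <- lsum_plus; apply lsum_ext; intros; now rewrite lsum_cons.
Qed.

Lemma Rabs_lsum_le {A : Type} (f : A -> R) (C : R) (l : list A) :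
  (forall x, In x l -> Rabs (f x) <= C) -> Rabs (lsum f l) <= INR (length l) * C.
Proof.
  induction l as [|x l IH]; intros H.
  - unfold lsum; simpl; rewrite Rabs_R0; lra.
  - rewrite lsum_cons; change (length (x :: l)) with (S (length l)); rewrite S_INR.
    apply Rle_trans with (1 := Rabs_triang _ _).
    assert (Rabs (f x) <= C) by (apply H; now left).
    assert (Rabs (lsum f l) <= INR (length l) * C) by (apply IH; intros; apply H; now right).
    lra.
Qed.

Lemma is_RInt_lsum {A : Type} (f : A -> R -> R) (v : A -> R) (a b : R) (l : list A) :
  (forall x, In x l -> is_RInt (f x) a b (v x)) ->
  is_RInt (fun s => lsum (fun x => f x s) l) a b (lsum v l).
Proof.
  induction l as [|x l IH]; intros H.
  - replace (lsum v nil) with (scal (b - a) 0)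
      by (unfold lsum, scal; simpl; unfold mult; simpl; ring).
    apply (is_RInt_const (V := R_NormedModule)).
  - rewrite lsum_cons; apply (is_RInt_plus (V := R_NormedModule)).
    + apply H; now left.
    + apply IH; intros; apply H; now right.
Qed.

Lemma lsum_words_S (d n : nat) (f : list nat -> R) :
  lsum f (words d (S n)) =
  lsum (fun w => lsum (fun i => f (i :: w)) (List.seq 0 d)) (words d n).
Proof.
  simpl; rewrite lsum_flat_map; apply lsum_ext; intros; apply lsum_map.
Qed.

(** [words] grows by prepending letters. For appended letters the induction peels one letter at each
    end and exchanges the two sums. *)
Lemma lsum_words_S_last (d n : nat) (f : list nat -> R) :
  lsum f (words d (S n)) =
  lsum (fun w => lsum (fun i => f (w ++ i :: nil)) (List.seq 0 d)) (words d n).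
Proof.
  revert f; induction n as [|n IH]; intros f.
  - apply lsum_words_S.
  - rewrite lsum_words_S, IH, lsum_words_S.
    apply lsum_ext; intros w _; apply lsum_swap.
Qed.

(** Reversal permutes the words of a given length. This removes the [rev] in [sig] once the kernel
    is summed over all words. *)
Lemma lsum_words_rev (d n : nat) (f : list nat -> R) :
  lsum (fun w => f (rev w)) (words d n) = lsum f (words d n).
Proof.
  revert f; induction n as [|n IH]; intros f; [reflexivity|].
  rewrite lsum_words_S, lsum_words_S_last.
  exact (IH (fun w => lsum (fun i => f (w ++ i :: nil)) (List.seq 0 d))).
Qed.

Lemma in_words (d n : nat) (w : list nat) :
  In w (words d n) -> length w = n /\ List.Forall (fun i => (i < d)%nat) w.
Proof.
  revert w; induction n as [|n IH]; simpl; intros w H.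
  - destruct H as [<-|[]]; auto.
  - apply in_flat_map in H; destruct H as (u & Hu & Hw).
    apply in_map_iff in Hw; destruct Hw as (i & <- & Hi); apply in_seq in Hi.
    destruct (IH u Hu) as [Hl Hf]; simpl; split; [lia|constructor; auto; lia].
Qed.

Lemma lsum_const {A : Type} (c : R) (l : list A) : lsum (fun _ => c) l = INR (length l) * c.
Proof.
  induction l as [|x l IH]; [unfold lsum; simpl; ring|].
  rewrite lsum_cons, IH; change (length (x :: l)) with (S (length l)); rewrite S_INR; ring.
Qed.

Lemma length_words (d n : nat) : INR (length (words d n)) = INR d ^ n.
Proof.
  rewrite <- (Rmult_1_r (INR _)), <- lsum_const.
  induction n as [|n IH]; [unfold lsum; simpl; ring|].
  rewrite lsum_words_S; simpl pow; rewrite <- IH, <- lsum_mult_l.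
  apply lsum_ext; intros; now rewrite lsum_const, length_seq.
Qed.

(** * Signatures from the left and from the right *)

(* Words are stored outermost letter first: [fwd x w s] is the signature
   coordinate of [rev w] on [0,s], and [bwd T x w s] that of [w] on [s,T], of a
   path with velocity [x]; [tangent x g w] is the derivative of [fwd x w] in
   the direction [g]. *)
Fixpoint fwd (x : nat -> R -> R) (w : list nat) (s : R) : R :=
  match w with
  | nil => 1
  | i :: w' => RInt (fun u => fwd x w' u * x i u) 0 s
  end.

Fixpoint bwd (T : R) (x : nat -> R -> R) (w : list nat) (s : R) : R :=
  match w with
  | nil => 1
  | i :: w' => RInt (fun u => bwd T x w' u * x i u) s T
  end.

Fixpoint tangent (x g : nat -> R -> R) (w : list nat) (s : R) : R :=
  match w with
  | nil => 0
  | i :: w' => RInt (fun u => tangent x g w' u * x i u + fwd x w' u * g i u) 0 s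
  end.

Lemma RInt_fun_ext (f g : R -> R) (a b : R) :
  (forall s : R, f s = g s) -> RInt f a b = RInt g a b.
Proof. intros H; apply (RInt_ext f g); auto. Qed.

Lemma fwd_continuous (L : list R) (x : nat -> R -> R) (w : list nat) (s : R) :
  (forall i, pw_cont L (x i)) -> continuous (fwd x w) s.
Proof.
  intros Hx; revert s; induction w as [|i w IH]; intros s; simpl.
  - apply (continuous_const (V := R_UniformSpace)).
  - apply (continuous_RInt_pw_cont L), pw_cont_mult; auto; now apply pw_cont_continuous.
Qed.

Lemma bwd_swap (T : R) (x : nat -> R -> R) (i : nat) (w : list nat) (L : list R) (s : R) :
  pw_cont L (fun u => bwd T x w u * x i u) ->
  bwd T x (i :: w) s = - RInt (fun u => bwd T x w u * x i u) T s.
Proof.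
  intros H; simpl; symmetry; apply (opp_RInt_swap (fun u => bwd T x w u * x i u)).
  now apply (ex_RInt_pw_cont L).
Qed.

Lemma bwd_continuous (L : list R) (T : R) (x : nat -> R -> R) (w : list nat) (s : R) :
  (forall i, pw_cont L (x i)) -> continuous (bwd T x w) s.
Proof.
  intros Hx; revert s; induction w as [|i w IH]; intros s.
  - apply (continuous_const (V := R_UniformSpace)).
  - assert (H : pw_cont L (fun u => bwd T x w u * x i u))
      by (apply pw_cont_mult; auto; now apply pw_cont_continuous).
    apply (continuous_ext (fun z => - RInt (fun u => bwd T x w u * x i u) T z)).
    + intros z; symmetry; now apply (bwd_swap T x i w L).
    + apply (continuous_opp (fun z => RInt (fun u => bwd T x w u * x i u) T z)).
      now apply (continuous_RInt_pw_cont L).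
Qed.

Lemma tangent_continuous (L : list R) (x g : nat -> R -> R) (w : list nat) (s : R) :
  (forall i, pw_cont L (x i)) -> (forall i, pw_cont L (g i)) -> continuous (tangent x g w) s.
Proof.
  intros Hx Hg; revert s; induction w as [|i w IH]; intros s; simpl.
  - apply (continuous_const (V := R_UniformSpace)).
  - apply (continuous_RInt_pw_cont L), pw_cont_plus; apply pw_cont_mult; auto;
      apply pw_cont_continuous; auto; intros; now apply (fwd_continuous L).
Qed.

Lemma pw_cont_fwd (L : list R) (x : nat -> R -> R) (w : list nat) :
  (forall i, pw_cont L (x i)) -> pw_cont L (fwd x w).
Proof. intros Hx; apply pw_cont_continuous; intros; now apply (fwd_continuous L). Qed.

Lemma pw_cont_bwd (L : list R) (T : R) (x : nat -> R -> R) (w : list nat) :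
  (forall i, pw_cont L (x i)) -> pw_cont L (bwd T x w).
Proof. intros Hx; apply pw_cont_continuous; intros; now apply (bwd_continuous L). Qed.

Lemma pw_cont_tangent (L : list R) (x g : nat -> R -> R) (w : list nat) :
  (forall i, pw_cont L (x i)) -> (forall i, pw_cont L (g i)) -> pw_cont L (tangent x g w).
Proof. intros Hx Hg; apply pw_cont_continuous; intros; now apply (tangent_continuous L). Qed.

#[local] Hint Resolve pw_cont_plus pw_cont_mult pw_cont_opp pw_cont_fwd pw_cont_bwd pw_cont_tangent : pw.

Lemma is_RInt_primitive (L : list R) (f : R -> R) (a u v : R) :
  pw_cont L f -> is_RInt f u v (RInt f a v - RInt f a u).
Proof.
  intros Hf.
  assert (E : RInt f a u + RInt f u v = RInt f a v)
    by (apply (RInt_Chasles f); now apply (ex_RInt_pw_cont L)).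
  replace (RInt f a v - RInt f a u) with (RInt f u v) by lra.
  now apply (is_RInt_pw_cont L).
Qed.

(** Moves one letter across the splitting time. By parts, as [bwd T x (j :: v)] has derivative
    [- bwd T x v * x j]; the boundary terms vanish because [F 0 = 0] and [bwd] of a nonempty word is
    0 at [T]. *)
Lemma RInt_mult_bwd (L : list R) (T : R) (x : nat -> R -> R) (f F : R -> R) (j : nat)
    (v : list nat) :
  0 < T -> (forall i, pw_cont L (x i)) -> pw_cont L f -> pw_cont L F ->
  (forall a b, is_RInt f a b (F b - F a)) -> F 0 = 0 ->
  RInt (fun s => F s * (bwd T x v s * x j s)) 0 T = RInt (fun s => f s * bwd T x (j :: v) s) 0 T.
Proof.
  intros HT Hx Hf HF Hprim H0.
  assert (Hb : pw_cont L (fun u => bwd T x v u * x j u)) by auto with pw.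
  assert (P : is_RInt (fun s => f s * bwd T x (j :: v) s + F s * - (bwd T x v s * x j s)) 0 T
    (F T * bwd T x (j :: v) T - F 0 * bwd T x (j :: v) 0)).
  { apply (RInt_by_parts L f (fun s => - (bwd T x v s * x j s)) F); auto with pw.
    intros a b; rewrite !(bwd_swap T x j v L) by auto.
    replace (- _ - - _) with
      (- (RInt (fun u => bwd T x v u * x j u) T b - RInt (fun u => bwd T x v u * x j u) T a))
      by ring.
    apply (is_RInt_opp (V := R_NormedModule)), (is_RInt_primitive L); auto. }
  assert (E : bwd T x (j :: v) T = 0) by (simpl; apply (RInt_point (V := R_CompleteNormedModule))).
  rewrite H0, E in P.
  assert (Q : is_RInt (fun s => f s * bwd T x (j :: v) s + F s * - (bwd T x v s * x j s)) 0 T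
    (RInt (fun s => f s * bwd T x (j :: v) s) 0 T
      + - RInt (fun s => F s * (bwd T x v s * x j s)) 0 T)).
  { apply (is_RInt_ext (fun s => f s * bwd T x (j :: v) s + - (F s * (bwd T x v s * x j s))));
      [intros; simpl; ring|].
    apply (is_RInt_plus (V := R_NormedModule)); [|apply (is_RInt_opp (V := R_NormedModule))];
      apply (is_RInt_pw_cont L); auto with pw. }
  pose proof (is_RInt_unique (V := R_CompleteNormedModule) _ _ _ _ P) as E1.
  rewrite (is_RInt_unique (V := R_CompleteNormedModule) _ _ _ _ Q) in E1; lra.
Qed.

(** The simplex of integration is sliced by the time [s] of the letter [i]: the letters of [u] come
    before [s], those of [v] after. The induction on [v] moves its letters one at a time by
    [RInt_mult_bwd]. *)
Lemma fwd_split (L : list R) (T : R) (x : nat -> R -> R) (u v : list nat) (i : nat) :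
  0 < T -> (forall i, pw_cont L (x i)) ->
  fwd x (rev v ++ i :: u) T = RInt (fun s => fwd x u s * x i s * bwd T x v s) 0 T.
Proof.
  intros HT Hx; revert u i; induction v as [|j v IH]; intros u i.
  - simpl; apply RInt_fun_ext; intros; simpl; ring.
  - replace (rev (j :: v) ++ i :: u) with (rev v ++ j :: i :: u)
      by (simpl; now rewrite <- app_assoc).
    rewrite IH.
    rewrite <- (RInt_mult_bwd L T x (fun s => fwd x u s * x i s) (fwd x (i :: u)));
      auto with pw.
    + apply RInt_fun_ext; intros; ring.
    + intros a b; apply (is_RInt_primitive L); auto with pw.
    + simpl; apply (RInt_point (V := R_CompleteNormedModule)).
Qed.

Lemma tangent_0 (x g : nat -> R -> R) (w : list nat) : tangent x g w 0 = 0.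
Proof. destruct w; simpl; auto; apply (RInt_point (V := R_CompleteNormedModule)). Qed.

(* The integral of d(tangent x g w) against [bwd T x v] on [0,T]. *)
Definition tangent_bwd (T : R) (x g : nat -> R -> R) (w v : list nat) : R :=
  match w with
  | nil => 0
  | i :: w' =>
      RInt (fun s => (tangent x g w' s * x i s + fwd x w' s * g i s) * bwd T x v s) 0 T
  end.

Lemma tangent_bwd_nil (T : R) (x g : nat -> R -> R) (w : list nat) :
  tangent_bwd T x g w nil = tangent x g w T.
Proof.
  destruct w as [|i w]; simpl; auto.
  apply RInt_fun_ext; intros; apply Rmult_1_r.
Qed.

(** Product rule at the latest letter of the first word: either the perturbation hits [j], or it
    hits an earlier letter and [j] is passed on to the backward word by parts. Iteration runs over
    all positions of the perturbed letter. *)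
Lemma tangent_bwd_cons (L : list R) (T : R) (x g : nat -> R -> R) (j : nat) (w v : list nat) :
  0 < T -> (forall i, pw_cont L (x i)) -> (forall i, pw_cont L (g i)) ->
  tangent_bwd T x g (j :: w) v =
  RInt (fun s => fwd x w s * g j s * bwd T x v s) 0 T + tangent_bwd T x g w (j :: v).
Proof.
  intros HT Hx Hg; unfold tangent_bwd at 1.
  transitivity (RInt (fun s => fwd x w s * g j s * bwd T x v s) 0 T
    + RInt (fun s => tangent x g w s * (bwd T x v s * x j s)) 0 T).
  { apply (is_RInt_unique (V := R_CompleteNormedModule)).
    apply (is_RInt_ext (fun s => fwd x w s * g j s * bwd T x v s
      + tangent x g w s * (bwd T x v s * x j s))); [intros; simpl; ring|].
    apply (is_RInt_plus (V := R_NormedModule)); apply (is_RInt_pw_cont L); auto 6 with pw. }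
  (* For the empty word both sides are 0. *)
  f_equal; destruct w as [|i w].
  - simpl.
    transitivity (RInt (fun _ : R => 0) 0 T).
    + apply RInt_fun_ext; intros; apply Rmult_0_l.
    + rewrite RInt_const; unfold scal; simpl; unfold mult; simpl; ring.
  - apply (RInt_mult_bwd L T x (fun s => tangent x g w s * x i s + fwd x w s * g i s));
      auto with pw.
    + intros a b; apply (is_RInt_primitive L); auto with pw.
    + apply tangent_0.
Qed.

(** * Factorial bounds and time reversal *)

Lemma ex_RInt_fwd (L : list R) (x : nat -> R -> R) (i : nat) (w : list nat) (a b : R) :
  (forall i, pw_cont L (x i)) -> ex_RInt (fun u => fwd x w u * x i u) a b.
Proof. intros Hx; apply (ex_RInt_pw_cont L); auto with pw. Qed.

Lemma fwd_bound (L : list R) (x : nat -> R -> R) (M : R) (w : list nat) (s : R) :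
  (forall i, pw_cont L (x i)) -> (forall i u, Rabs (x i u) <= M) -> 0 <= s ->
  Rabs (fwd x w s) <= 1 * M ^ length w * s ^ length w / INR (fact (length w)).
Proof.
  intros Hx HM; revert s; induction w as [|i w IH]; intros s Hs.
  - simpl; rewrite Rabs_R1; lra.
  - change (length (i :: w)) with (S (length w)); simpl fwd.
    apply RInt_power_le; auto; [now apply (ex_RInt_fwd L)|].
    intros u Hu; rewrite Rabs_mult; apply Rle_trans with
      (1 * M ^ length w * u ^ length w / INR (fact (length w)) * M).
    + apply Rmult_le_compat; auto using Rabs_pos; apply IH; lra.
    + right; simpl; field; apply INR_fact_neq_0.
Qed.

Lemma pw_cont_perturb (L : list R) (x g : nat -> R -> R) (e : R) :
  (forall i, pw_cont L (x i)) -> (forall i, pw_cont L (g i)) ->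
  forall i, pw_cont L (fun u => x i u + e * g i u).
Proof.
  intros Hx Hg i; apply pw_cont_plus; auto; apply pw_cont_mult; auto.
  apply pw_cont_continuous; intros; apply (continuous_const (V := R_UniformSpace)).
Qed.

(** The integrand difference is (difference for w) * xe + fwd * (e g), where |xe| <= 2M because |e|
    <= 1. The rate 3M works since 2 * 3^n + 1 <= 3^(n+1). *)
Lemma fwd_perturb_bound (L : list R) (x g : nat -> R -> R) (M e : R) (w : list nat) (s : R) :
  (forall i, pw_cont L (x i)) -> (forall i, pw_cont L (g i)) ->
  (forall i u, Rabs (x i u) <= M) -> (forall i u, Rabs (g i u) <= M) -> Rabs e <= 1 -> 0 <= s ->
  Rabs (fwd (fun i u => x i u + e * g i u) w s - fwd x w s) <=
  Rabs e * (3 * M) ^ length w * s ^ length w / INR (fact (length w)).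
Proof.
  intros Hx Hg HxM HgM He; revert s; induction w as [|i w IH]; intros s Hs.
  - simpl; rewrite Rminus_diag, Rabs_R0; pose proof (Rabs_pos e); lra.
  - assert (HM : 0 <= M) by (apply Rle_trans with (2 := HxM O 0), Rabs_pos).
    set (xe := fun i u => x i u + e * g i u) in *.
    assert (Hxe : forall i, pw_cont L (xe i)) by now apply pw_cont_perturb.
    change (length (i :: w)) with (S (length w)); simpl fwd.
    assert (E : is_RInt (fun u => fwd xe w u * xe i u - fwd x w u * x i u) 0 s
      (RInt (fun u => fwd xe w u * xe i u) 0 s - RInt (fun u => fwd x w u * x i u) 0 s)).
    { apply (is_RInt_minus (V := R_NormedModule)); apply (is_RInt_pw_cont L); auto with pw. }
    rewrite <- (is_RInt_unique (V := R_CompleteNormedModule) _ _ _ _ E).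
    apply RInt_power_le; auto; [eexists; apply E|].
    intros u Hu; specialize (IH u (proj1 Hu)).
    pose proof (fwd_bound L x M w u Hx HxM (proj1 Hu)) as Hb.
    set (n := length w) in *; set (q := u ^ n / INR (fact n)).
    assert (Hq : 0 <= q).
    { apply Rmult_le_pos; [apply pow_le; lra|apply Rlt_le, Rinv_0_lt_compat, INR_fact_lt_0]. }
    replace (fwd xe w u * xe i u - fwd x w u * x i u) with
      ((fwd xe w u - fwd x w u) * xe i u + fwd x w u * (e * g i u)) by (unfold xe; ring).
    apply Rle_trans with (1 := Rabs_triang _ _); rewrite !Rabs_mult.
    assert (Hxeb : Rabs (xe i u) <= 2 * M).
    { unfold xe; apply Rle_trans with (1 := Rabs_triang _ _); rewrite Rabs_mult.
      pose proof (HxM i u); pose proof (HgM i u); pose proof (Rabs_pos e);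
        pose proof (Rabs_pos (g i u)); nra. }
    apply Rle_trans with (Rabs e * (3 ^ n * M ^ n) * q * (2 * M) + M ^ n * q * (Rabs e * M)).
    + apply Rplus_le_compat.
      * apply Rmult_le_compat; auto using Rabs_pos.
        apply Rle_trans with (1 := IH); right; rewrite Rpow_mult_distr; unfold q, Rdiv; ring.
      * apply Rmult_le_compat; auto using Rabs_pos.
        -- rewrite <- Rabs_mult; apply Rabs_pos.
        -- apply Rle_trans with (1 := Hb); right; unfold q, Rdiv; ring.
        -- apply Rmult_le_compat_l; auto using Rabs_pos.
    + replace (Rabs e * (3 * M) ^ S n * u ^ n / INR (fact n)) with
        (Rabs e * (3 ^ n * M ^ n) * q * (3 * M))
        by (rewrite Rpow_mult_distr; unfold q, Rdiv; simpl; ring).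
      assert (H3 : 1 <= 3 ^ n) by (apply pow_R1_Rle; lra).
      assert (H0 : 0 <= Rabs e * M ^ n * q * M).
      { repeat first [assumption | apply Rabs_pos | apply pow_le | apply Rmult_le_pos]. }
      assert (H1 : 0 <= (Rabs e * M ^ n * q * M) * (3 ^ n - 1)) by (apply Rmult_le_pos; lra).
      clear - H1; lra.
Qed.

(** The integrand remainder is (remainder for w) * x + (difference for w) * (e g), and the second
    product is of order e^2 by [fwd_perturb_bound]. The rate 4M works since 4^n + 3^n <= 4^(n+1). *)
Lemma fwd_taylor_bound (L : list R) (x g : nat -> R -> R) (M e : R) (w : list nat) (s : R) :
  (forall i, pw_cont L (x i)) -> (forall i, pw_cont L (g i)) ->
  (forall i u, Rabs (x i u) <= M) -> (forall i u, Rabs (g i u) <= M) -> Rabs e <= 1 -> 0 <= s ->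
  Rabs (fwd (fun i u => x i u + e * g i u) w s - fwd x w s - e * tangent x g w s) <=
  e ^ 2 * (4 * M) ^ length w * s ^ length w / INR (fact (length w)).
Proof.
  intros Hx Hg HxM HgM He; revert s; induction w as [|i w IH]; intros s Hs.
  - simpl; rewrite Rminus_diag, Rmult_0_r, Rminus_diag, Rabs_R0; nra.
  - assert (HM : 0 <= M) by (apply Rle_trans with (2 := HxM O 0), Rabs_pos).
    pose proof (fun u => fwd_perturb_bound L x g M e w u Hx Hg HxM HgM He) as Hp.
    set (xe := fun i u => x i u + e * g i u) in *.
    assert (Hxe : forall i, pw_cont L (xe i)) by now apply pw_cont_perturb.
    change (length (i :: w)) with (S (length w)); simpl fwd; simpl tangent.
    assert (E : is_RInt (fun u => fwd xe w u * xe i u - fwd x w u * x i u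
        - e * (tangent x g w u * x i u + fwd x w u * g i u)) 0 s
      (RInt (fun u => fwd xe w u * xe i u) 0 s - RInt (fun u => fwd x w u * x i u) 0 s
        - e * RInt (fun u => tangent x g w u * x i u + fwd x w u * g i u) 0 s)).
    { apply (is_RInt_minus (V := R_NormedModule));
        [apply (is_RInt_minus (V := R_NormedModule))|apply (is_RInt_scal (V := R_NormedModule))];
        apply (is_RInt_pw_cont L); auto with pw. }
    rewrite <- (is_RInt_unique (V := R_CompleteNormedModule) _ _ _ _ E).
    apply RInt_power_le; auto; [eexists; apply E|].
    intros u Hu; specialize (IH u (proj1 Hu)); specialize (Hp u (proj1 Hu)).
    set (n := length w) in *; set (q := u ^ n / INR (fact n)).
    assert (Hq : 0 <= q).
    { apply Rmult_le_pos; [apply pow_le; lra|apply Rlt_le, Rinv_0_lt_compat, INR_fact_lt_0]. }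
    replace (fwd xe w u * xe i u - fwd x w u * x i u
        - e * (tangent x g w u * x i u + fwd x w u * g i u)) with
      ((fwd xe w u - fwd x w u - e * tangent x g w u) * x i u
        + (fwd xe w u - fwd x w u) * (e * g i u)) by (unfold xe; ring).
    apply Rle_trans with (1 := Rabs_triang _ _); rewrite !Rabs_mult.
    apply Rle_trans with (e ^ 2 * (4 ^ n * M ^ n) * q * M
      + Rabs e * (3 ^ n * M ^ n) * q * (Rabs e * M)).
    + apply Rplus_le_compat.
      * apply Rmult_le_compat; auto using Rabs_pos.
        apply Rle_trans with (1 := IH); right; rewrite Rpow_mult_distr; unfold q, Rdiv; ring.
      * apply Rmult_le_compat; auto using Rabs_pos.
        -- rewrite <- Rabs_mult; apply Rabs_pos.
        -- apply Rle_trans with (1 := Hp); right; rewrite Rpow_mult_distr; unfold q, Rdiv; ring.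
        -- apply Rmult_le_compat_l; auto using Rabs_pos.
    + replace (e ^ 2 * (4 * M) ^ S n * u ^ n / INR (fact n)) with
        (e ^ 2 * (4 ^ n * M ^ n) * q * (4 * M))
        by (rewrite Rpow_mult_distr; unfold q, Rdiv; simpl; ring).
      replace (Rabs e * (3 ^ n * M ^ n) * q * (Rabs e * M)) with
        (Rabs e ^ 2 * (3 ^ n * M ^ n) * q * M) by ring.
      rewrite pow2_abs.
      assert (H3 : 3 ^ n <= 4 ^ n) by (apply pow_incr; lra).
      assert (H4 : 0 <= 4 ^ n) by (apply pow_le; lra).
      assert (H0 : 0 <= e ^ 2 * M ^ n * q * M).
      { repeat first [assumption | apply pow2_ge_0 | apply pow_le | apply Rmult_le_pos]. }
      assert (H1 : 0 <= (e ^ 2 * M ^ n * q * M) * (3 * 4 ^ n - 3 ^ n))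
        by (apply Rmult_le_pos; lra).
      clear - H1; lra.
Qed.

Definition reflect (T : R) (L : list R) : list R := map (fun p => T - p) L.

Lemma pw_cont_reflect (T : R) (L : list R) (f : R -> R) :
  pw_cont L f -> pw_cont (reflect T L) (fun u => f (T - u)).
Proof.
  intros Hf a b Hab F; destruct (Hf (T - b) (T - a)) as (h & Ch & Eh); [lra| |].
  - intros p Hp Hpab; apply (F (T - p)); [|lra].
    apply in_map_iff; exists p; auto.
  - exists (fun u => h (T - u)); split; [|intros s Hs; apply Eh; lra].
    intros s; apply (continuous_comp (fun u : R => T - u) h); auto.
    apply (ex_derive_continuous (V := R_NormedModule)); auto_derive; auto.
Qed.

(** Substitution of T - u for u, letter by letter. The velocity is reflected but not negated here;
    the sign of the reversed path is treated separately in [fwd_opp]. *)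
Lemma bwd_fwd (T : R) (L : list R) (x : nat -> R -> R) (w : list nat) (s : R) :
  (forall i, pw_cont L (x i)) ->
  bwd T x w s = fwd (fun i u => x i (T - u)) w (T - s).
Proof.
  intros Hx; revert s; induction w as [|i w IH]; intros s; [reflexivity|]; simpl.
  assert (Hb : pw_cont L (fun u => bwd T x w u * x i u)) by auto with pw.
  rewrite (RInt_fun_ext (fun u => fwd (fun i u => x i (T - u)) w u * x i (T - u))
    (fun u => bwd T x w (T - u) * x i (T - u))).
  2:{ intros u; rewrite IH; do 2 f_equal; ring. }
  (* The slope -1 contributes a sign, which cancels against the exchange of the two bounds. *)
  pose proof (is_RInt_comp_lin (V := R_NormedModule) (fun u => bwd T x w u * x i u) (-1) T
    (T - s) 0 _ (is_RInt_pw_cont L _ (-1 * (T - s) + T) (-1 * 0 + T) Hb)) as E.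
  replace (-1 * (T - s) + T) with s in E by ring; replace (-1 * 0 + T) with T in E by ring.
  apply (is_RInt_swap (V := R_NormedModule)), (is_RInt_opp (V := R_NormedModule)) in E.
  rewrite opp_opp in E; symmetry; apply (is_RInt_unique (V := R_CompleteNormedModule)).
  revert E; apply (is_RInt_ext (V := R_NormedModule)); intros u _.
  replace (T - u) with (-1 * u + T) by ring; unfold opp, scal; simpl; unfold mult; simpl; ring.
Qed.

Lemma bwd_bound (T : R) (L : list R) (x : nat -> R -> R) (M : R) (w : list nat) (s : R) :
  (forall i, pw_cont L (x i)) -> (forall i u, Rabs (x i u) <= M) -> s <= T ->
  Rabs (bwd T x w s) <= 1 * M ^ length w * (T - s) ^ length w / INR (fact (length w)).
Proof.
  intros Hx HM Hs; rewrite (bwd_fwd T L) by auto.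
  apply (fwd_bound (reflect T L)); auto; [|lra].
  intros i; now apply (pw_cont_reflect T L (x i)).
Qed.

Lemma fwd_opp (L : list R) (x : nat -> R -> R) (w : list nat) (s : R) :
  (forall i, pw_cont L (x i)) ->
  fwd (fun i u => - x i u) w s = (-1) ^ length w * fwd x w s.
Proof.
  intros Hx; revert s; induction w as [|i w IH]; intros s; simpl; [ring|].
  apply (is_RInt_unique (V := R_CompleteNormedModule)).
  apply (is_RInt_ext (fun u => -1 * (-1) ^ length w * (fwd x w u * x i u))).
  - intros u _; simpl; rewrite IH; ring.
  - apply (is_RInt_scal (V := R_NormedModule)), (is_RInt_pw_cont L); auto with pw.
Qed.

(** * The derivative of the kernel as a double integral *)

(** With [x] and [y] the velocities of X and Y, these two definitions are the contributions of words
    of length [n] to U(s,t) and to the reversed kernel at (T-s,T-t); see [sigker_fwd] and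
    [sigker_rev_bwd]. *)
Definition fwd_level (d : nat) (x y : nat -> R -> R) (n : nat) (s t : R) : R :=
  lsum (fun w => fwd x w s * fwd y w t) (words d n).

Definition bwd_level (T : R) (d : nat) (x y : nat -> R -> R) (n : nat) (s t : R) : R :=
  lsum (fun w => bwd T x w s * bwd T y w t) (words d n).

Lemma ex_series_pow_fact (c : R) : ex_series (fun n => c ^ n / INR (fact n)).
Proof.
  exists (exp c); apply (is_series_ext (fun k => scal (pow_n c k) (/ INR (fact k)))).
  - intros n; rewrite pow_n_pow; reflexivity.
  - apply is_exp_Reals.
Qed.

(** There are d^n words, and each product has n! squared in the denominator; one factorial is given
    up so that the bound is a term of an exponential series. *)
Lemma lsum_words_bound (d n : nat) (f g : list nat -> R) (A a b : R) :
  0 <= A -> 0 <= a -> 0 <= b ->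
  (forall w, length w = n -> Rabs (f w) <= A * a ^ n / INR (fact n)) ->
  (forall w, length w = n -> Rabs (g w) <= b ^ n / INR (fact n)) ->
  Rabs (lsum (fun w => f w * g w) (words d n)) <= A * ((INR d * a * b) ^ n / INR (fact n)).
Proof.
  intros HA Ha Hb Hf Hg.
  assert (Hn : 0 < INR (fact n)) by apply INR_fact_lt_0.
  assert (Hi : / INR (fact n) <= 1).
  { rewrite <- Rinv_1; apply Rinv_le_contravar; [lra|].
    change 1 with (INR 1); apply le_INR, (lt_O_fact n). }
  assert (Hi0 : 0 < / INR (fact n)) by now apply Rinv_0_lt_compat.
  apply Rle_trans with (INR (length (words d n)) *
    ((A * a ^ n / INR (fact n)) * (b ^ n / INR (fact n)))).
  - apply Rabs_lsum_le; intros w Hw; apply in_words in Hw; destruct Hw as [Hw _].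
    rewrite Rabs_mult; apply Rmult_le_compat; auto using Rabs_pos.
  - rewrite length_words, !Rpow_mult_distr.
    assert (H0 : 0 <= INR d ^ n * A * a ^ n * b ^ n * / INR (fact n))
      by (repeat first [assumption | apply pos_INR | apply pow_le | apply Rmult_le_pos]; lra).
    unfold Rdiv.
    replace (INR d ^ n * (A * a ^ n * / INR (fact n) * (b ^ n * / INR (fact n)))) with
      (INR d ^ n * A * a ^ n * b ^ n * / INR (fact n) * / INR (fact n)) by ring.
    apply Rle_trans with (INR d ^ n * A * a ^ n * b ^ n * / INR (fact n) * 1); [|right; ring].
    now apply Rmult_le_compat_l.
Qed.

Lemma pow_fact_le (c s T : R) (n : nat) :
  0 <= c -> 0 <= s <= T -> 1 * c ^ n * s ^ n / INR (fact n) <= (c * T) ^ n / INR (fact n).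
Proof.
  intros Hc Hs; apply Rmult_le_compat_r; [apply Rlt_le, Rinv_0_lt_compat, INR_fact_lt_0|].
  rewrite Rmult_1_l, Rpow_mult_distr; apply Rmult_le_compat_l; [now apply pow_le|].
  now apply pow_incr.
Qed.

Lemma fwd_bound_unif (L : list R) (x : nat -> R -> R) (M T : R) (w : list nat) (s : R) :
  (forall i, pw_cont L (x i)) -> (forall i u, Rabs (x i u) <= M) -> 0 <= s <= T ->
  Rabs (fwd x w s) <= (M * T) ^ length w / INR (fact (length w)).
Proof.
  intros Hx HM Hs; apply Rle_trans with (1 := fwd_bound L x M w s Hx HM (proj1 Hs)).
  apply pow_fact_le; auto; apply Rle_trans with (2 := HM O 0), Rabs_pos.
Qed.

Lemma bwd_bound_unif (L : list R) (x : nat -> R -> R) (M T : R) (w : list nat) (s : R) :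
  (forall i, pw_cont L (x i)) -> (forall i u, Rabs (x i u) <= M) -> 0 <= s <= T ->
  Rabs (bwd T x w s) <= (M * T) ^ length w / INR (fact (length w)).
Proof.
  intros Hx HM Hs; apply Rle_trans with (1 := bwd_bound T L x M w s Hx HM (proj2 Hs)).
  apply pow_fact_le; [apply Rle_trans with (2 := HM O 0), Rabs_pos|lra].
Qed.

Section SplitWords.

Variables (L : list R) (T M : R) (d : nat) (x g y : nat -> R -> R).
Hypothesis HT : 0 < T.
Hypothesis Hx : forall i, pw_cont L (x i).
Hypothesis Hg : forall i, pw_cont L (g i).
Hypothesis Hy : forall i, pw_cont L (y i).
Hypothesis HxM : forall i u, Rabs (x i u) <= M.
Hypothesis HgM : forall i u, Rabs (g i u) <= M.
Hypothesis HyM : forall i u, Rabs (y i u) <= M.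

Let HM : 0 <= M.
Proof. apply Rle_trans with (2 := HxM O 0), Rabs_pos. Qed.

Let rate : R := INR d * (M * T) * (M * T).

Let rate_pos : 0 <= rate.
Proof. unfold rate; repeat apply Rmult_le_pos; auto using pos_INR; lra. Qed.

Lemma fwd_level_bound (n : nat) (s t : R) :
  0 <= s <= T -> 0 <= t <= T -> Rabs (fwd_level d x y n s t) <= rate ^ n / INR (fact n).
Proof.
  intros Hs Ht; rewrite <- (Rmult_1_l (_ / _)).
  assert (0 <= M * T) by (apply Rmult_le_pos; lra).
  apply lsum_words_bound; try lra; intros w <-; rewrite ?Rmult_1_l.
  - now apply (fwd_bound_unif L).
  - now apply (fwd_bound_unif L).
Qed.

Lemma bwd_level_bound (n : nat) (s t : R) :
  0 <= s <= T -> 0 <= t <= T -> Rabs (bwd_level T d x y n s t) <= rate ^ n / INR (fact n).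
Proof.
  intros Hs Ht; rewrite <- (Rmult_1_l (_ / _)).
  assert (0 <= M * T) by (apply Rmult_le_pos; lra).
  apply lsum_words_bound; try lra; intros w <-; rewrite ?Rmult_1_l.
  - now apply (bwd_bound_unif L).
  - now apply (bwd_bound_unif L).
Qed.

(** The arguments shadow the section variables because two instances occur: [x g] gives the effect
    of perturbing the letter [j], and [y y] gives a full coordinate of Y by [fwd_split]. *)
Definition split_coeff (x g : nat -> R -> R) (w v : list nat) (j : nat) : R :=
  RInt (fun s => fwd x w s * g j s * bwd T x v s) 0 T.

Definition split_sum (l m : nat) : R :=
  lsum (fun w => lsum (fun v => lsum (fun j =>
    split_coeff x g w v j * split_coeff y y w v j)
    (List.seq 0 d)) (words d l)) (words d m).

Definition split_sum_at (l m : nat) (t : R) : R :=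
  lsum (fun w => lsum (fun v => lsum (fun j =>
    split_coeff x g w v j * (fwd y w t * y j t * bwd T y v t))
    (List.seq 0 d)) (words d l)) (words d m).

(** Each use of [tangent_bwd_cons] yields one [split_sum] and moves a letter from [w] to [v],
    leaving the word [rev v ++ w] unchanged. The general [l] counts the letters already moved. *)
Lemma tangent_bwd_split (m l : nat) :
  lsum (fun w => lsum (fun v => tangent_bwd T x g w v * fwd y (rev v ++ w) T)
    (words d l)) (words d (S m)) =
  sum_f_R0 (fun k => split_sum (l + k) (m - k)) m.
Proof.
  assert (E : forall m l, lsum (fun w => lsum (fun v => tangent_bwd T x g w v * fwd y (rev v ++ w) T)
      (words d l)) (words d (S m)) = split_sum l m +
    lsum (fun w => lsum (fun v => tangent_bwd T x g w v * fwd y (rev v ++ w) T)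
      (words d (S l))) (words d m)).
  { clear m l; intros m l; rewrite lsum_words_S; unfold split_sum; rewrite <- lsum_plus.
    apply lsum_ext; intros w _; rewrite (lsum_swap _ (List.seq 0 d)), lsum_words_S, <- lsum_plus.
    apply lsum_ext; intros v _; rewrite <- lsum_plus; apply lsum_ext; intros j _.
    rewrite (tangent_bwd_cons L) by auto.
    replace (rev (j :: v) ++ w) with (rev v ++ j :: w) by (simpl; now rewrite <- app_assoc).
    rewrite (fwd_split L) by auto; unfold split_coeff; ring. }
  revert l; induction m as [|m IH]; intros l.
  - rewrite E; simpl; rewrite Nat.add_0_r.
    (* No letter is left in the first word, so every [tangent_bwd] in this sum is 0. *)
    match goal with |- _ + ?z = _ => replace z with 0; [ring|] end.
    unfold lsum at 1; simpl.
    match goal with |- _ = ?z + 0 => replace z with 0; [ring|] end.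
    symmetry; rewrite (lsum_ext _ (fun _ => 0)) by (intros; apply Rmult_0_l); apply lsum_0.
  - rewrite E, IH, (decomp_sum _ (S m)) by lia.
    rewrite Nat.add_0_r, Nat.sub_0_r; f_equal; simpl pred; apply sum_eq; intros k Hk.
    f_equal; lia.
Qed.

(** The perturbed letter accounts for the shift: words of length n + 1 leave n letters to share
    between the two sides. *)
Lemma lsum_tangent_fwd (n : nat) :
  lsum (fun w => tangent x g w T * fwd y w T) (words d (S n)) =
  sum_f_R0 (fun k => split_sum k (n - k)) n.
Proof.
  transitivity (sum_f_R0 (fun k => split_sum (0 + k) (n - k)) n); [|reflexivity].
  rewrite <- tangent_bwd_split; apply lsum_ext; intros w _.
  unfold lsum; simpl; rewrite tangent_bwd_nil; ring.
Qed.

Lemma is_RInt_split_sum_inner (l m : nat) (t : R) :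
  is_RInt (fun s => bwd_level T d x y l s t * fwd_level d x y m s t *
    inner d (fun i => g i s) (fun i => y i t)) 0 T (split_sum_at l m t).
Proof.
  apply (is_RInt_ext (fun s => lsum (fun w => lsum (fun v => lsum (fun j =>
    (fwd y w t * y j t * bwd T y v t) * (fwd x w s * g j s * bwd T x v s))
    (List.seq 0 d)) (words d l)) (words d m))).
  - intros s _; unfold bwd_level, fwd_level, inner; fold (lsum (fun i => g i s * y i t) (List.seq 0 d)).
    rewrite (Rmult_comm (lsum _ (words d l))), lsum_mult, <- lsum_mult_r.
    apply lsum_ext; intros w _; rewrite lsum_mult.
    apply lsum_ext; intros v _; apply lsum_ext; intros j _; ring.
  - apply is_RInt_lsum; intros w _; apply is_RInt_lsum; intros v _; apply is_RInt_lsum; intros j _.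
    unfold split_coeff; rewrite (Rmult_comm (RInt _ _ _)); apply (is_RInt_scal (V := R_NormedModule)).
    apply (is_RInt_pw_cont L); auto with pw.
Qed.

Lemma is_RInt_split_sum_at (l m : nat) :
  is_RInt (split_sum_at l m) 0 T (split_sum l m).
Proof.
  apply is_RInt_lsum; intros w _; apply is_RInt_lsum; intros v _; apply is_RInt_lsum; intros j _.
  apply (is_RInt_scal (V := R_NormedModule)).
  apply (is_RInt_pw_cont L); auto with pw.
Qed.

(** The term of index [n] in the Cauchy product of the two kernel series; grouping by total length
    matches [lsum_tangent_fwd]. *)
Definition cauchy_level (n : nat) (s t : R) : R :=
  sum_f_R0 (fun k => bwd_level T d x y k s t * fwd_level d x y (n - k) s t) n.

Let rate_cauchy (n : nat) : R :=
  sum_f_R0 (fun k => rate ^ k / INR (fact k) * (rate ^ (n - k) / INR (fact (n - k)))) n.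

Let pow_fact_pos (k : nat) : 0 <= rate ^ k / INR (fact k).
Proof.
  apply Rmult_le_pos; [now apply pow_le|apply Rlt_le, Rinv_0_lt_compat, INR_fact_lt_0].
Qed.

Lemma ex_series_rate_cauchy : ex_series rate_cauchy.
Proof.
  destruct (ex_series_pow_fact rate) as (l & Hl); exists (l * l).
  assert (Ha : ex_series (fun n => Rabs (rate ^ n / INR (fact n)))).
  { exists l; apply (is_series_ext (fun n => rate ^ n / INR (fact n))); auto.
    intros n; symmetry; now apply Rabs_pos_eq. }
  now apply (is_series_mult (fun k => rate ^ k / INR (fact k))
    (fun k => rate ^ k / INR (fact k)) l l).
Qed.

Lemma is_series_cauchy_level (s t : R) :
  0 <= s <= T -> 0 <= t <= T ->
  is_series (fun n => cauchy_level n s t)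
    (Series (fun n => bwd_level T d x y n s t) * Series (fun n => fwd_level d x y n s t)).
Proof.
  intros Hs Ht.
  assert (Hb : ex_series (fun n => Rabs (bwd_level T d x y n s t))).
  { apply (ex_series_le (V := R_CompleteNormedModule) _ (fun n => rate ^ n / INR (fact n)));
      [|apply ex_series_pow_fact].
    intros n; unfold norm; simpl; unfold abs; simpl; rewrite Rabs_Rabsolu.
    now apply bwd_level_bound. }
  assert (Hf : ex_series (fun n => Rabs (fwd_level d x y n s t))).
  { apply (ex_series_le (V := R_CompleteNormedModule) _ (fun n => rate ^ n / INR (fact n)));
      [|apply ex_series_pow_fact].
    intros n; unfold norm; simpl; unfold abs; simpl; rewrite Rabs_Rabsolu.
    now apply fwd_level_bound. }
  apply (is_series_mult (fun n => bwd_level T d x y n s t) (fun n => fwd_level d x y n s t));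
    auto; apply Series_correct; now apply ex_series_Rabs.
Qed.

Lemma cauchy_level_inner_bound (n : nat) (s t : R) :
  0 <= s <= T -> 0 <= t <= T ->
  Rabs (cauchy_level n s t * inner d (fun i => g i s) (fun i => y i t)) <=
  rate_cauchy n * (INR d * (M * M)).
Proof.
  intros Hs Ht; rewrite Rabs_mult; apply Rmult_le_compat; auto using Rabs_pos.
  - apply Rle_trans with (1 := Rsum_abs _ _); apply sum_Rle; intros k Hk.
    rewrite Rabs_mult; apply Rmult_le_compat; auto using Rabs_pos.
    + now apply bwd_level_bound.
    + now apply fwd_level_bound.
  - rewrite <- (length_seq d 0) at 2; apply Rabs_lsum_le; intros i _.
    rewrite Rabs_mult; apply Rmult_le_compat; auto using Rabs_pos.
Qed.

Lemma is_RInt_sum_f_R0 (f : nat -> R -> R) (v : nat -> R) (a b : R) (n : nat) :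
  (forall k, is_RInt (f k) a b (v k)) ->
  is_RInt (fun s => sum_f_R0 (fun k => f k s) n) a b (sum_f_R0 v n).
Proof.
  intros H; induction n as [|n IH]; simpl; auto.
  now apply (is_RInt_plus (V := R_NormedModule)).
Qed.

Lemma is_RInt_cauchy_level (n : nat) (t : R) :
  is_RInt (fun s => cauchy_level n s t * inner d (fun i => g i s) (fun i => y i t)) 0 T
    (sum_f_R0 (fun k => split_sum_at k (n - k) t) n).
Proof.
  apply (is_RInt_ext (fun s => sum_f_R0 (fun k => bwd_level T d x y k s t *
    fwd_level d x y (n - k) s t * inner d (fun i => g i s) (fun i => y i t)) n)).
  - intros s _; unfold cauchy_level; rewrite Rmult_comm, scal_sum; reflexivity.
  - apply (is_RInt_sum_f_R0 (fun k s => bwd_level T d x y k s t *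
      fwd_level d x y (n - k) s t * inner d (fun i => g i s) (fun i => y i t))).
    intros k; apply is_RInt_split_sum_inner.
Qed.

(** The product of the kernels is expanded as a Cauchy series and integrated termwise twice, first
    in [s] for fixed [t], then in [t]. *)
Lemma is_RInt_kernels :
  is_RInt (fun t => RInt (fun s => Series (fun n => fwd_level d x y n s t) *
      Series (fun n => bwd_level T d x y n s t) *
      inner d (fun i => g i s) (fun i => y i t)) 0 T) 0 T
    (Series (fun n => lsum (fun w => tangent x g w T * fwd y w T) (words d (S n)))).
Proof.
  set (m := fun n => rate_cauchy n * (INR d * (M * M))).
  assert (Hm : ex_series m) by (apply ex_series_scal_r, ex_series_rate_cauchy).
  apply (is_RInt_ext (fun t => Series (fun n => sum_f_R0 (fun k => split_sum_at k (n - k) t) n))).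
  - intros t; rewrite Rmin_left, Rmax_right by lra; intros Ht; symmetry.
    apply (is_RInt_unique (V := R_CompleteNormedModule)).
    apply (is_RInt_ext (fun s => Series (fun n =>
      cauchy_level n s t * inner d (fun i => g i s) (fun i => y i t)))).
    + intros s; rewrite Rmin_left, Rmax_right by lra; intros Hs.
      rewrite Series_scal_r; apply Rmult_eq_compat_r.
      rewrite Rmult_comm; apply is_series_unique, is_series_cauchy_level; lra.
    + apply (is_RInt_Series _ m); auto; try lra.
      * intros n; apply is_RInt_cauchy_level.
      * intros n s Hs; apply cauchy_level_inner_bound; lra.
  (* The terms are now integrals over [0,T] of functions bounded by [m n], hence the factor [T]. *)
  - apply (is_RInt_Series _ (fun n => T * m n)); try lra.
    + intros n; rewrite lsum_tangent_fwd.
      apply (is_RInt_sum_f_R0 (fun k => split_sum_at k (n - k))).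
      intros k; apply is_RInt_split_sum_at.
    + intros n t Ht.
      rewrite <- (is_RInt_unique (V := R_CompleteNormedModule) _ _ _ _ (is_RInt_cauchy_level n t)).
      replace T with (T - 0) at 2 by ring.
      apply abs_RInt_le_const; [lra|eexists; apply is_RInt_cauchy_level|].
      intros s Hs; now apply cauchy_level_inner_bound.
    + now apply (ex_series_scal_l T m).
Qed.

(** The second-order bounds are summed over all words to give |k(e) - k(0) - e k'| <= K e^2 for |e|
    <= 1, from which the derivative is read off directly. *)
Lemma is_derive_fwd_series :
  is_derive (fun e => Series (fun n => lsum (fun w =>
      fwd (fun i u => x i u + e * g i u) w T * fwd y w T) (words d n))) 0
    (Series (fun n => lsum (fun w => tangent x g w T * fwd y w T) (words d (S n)))).
Proof.
  assert (HMT : 0 <= M * T) by (apply Rmult_le_pos; lra).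
  assert (HT' : 0 <= T <= T) by lra.
  (* The rates 3M and 4M come from [fwd_perturb_bound] and [fwd_taylor_bound], the other factor from
     the bound on Y. *)
  set (c3 := INR d * (3 * M * T) * (M * T)); set (c4 := INR d * (4 * M * T) * (M * T)).
  set (f := fun e n => lsum (fun w =>
    fwd (fun i u => x i u + e * g i u) w T * fwd y w T) (words d n)).
  set (f' := fun n => lsum (fun w => tangent x g w T * fwd y w T) (words d n)).
  (* The velocity x + 0 * g equals x only pointwise, so the equality is carried through the iterated
     integrals. *)
  assert (E0 : forall n, lsum (fun w => fwd x w T * fwd y w T) (words d n) = f 0 n).
  { intros n; apply lsum_ext; intros w _; f_equal.
    clear - x g; revert T; induction w as [|i w IH]; intros T; simpl; auto.
    apply RInt_fun_ext; intros u; rewrite IH; ring. }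
  assert (Hf0 : ex_series (f 0)).
  { apply (ex_series_le (V := R_CompleteNormedModule) _ (fun n => rate ^ n / INR (fact n)));
      [|apply ex_series_pow_fact].
    intros n; rewrite <- E0; now apply fwd_level_bound. }
  assert (B1 : forall e n, Rabs e <= 1 ->
    Rabs (f e n - f 0 n) <= Rabs e * (c3 ^ n / INR (fact n))).
  { intros e n He; rewrite <- E0; unfold f.
    rewrite <- lsum_minus, (lsum_ext _ (fun w =>
      (fwd (fun i u => x i u + e * g i u) w T - fwd x w T) * fwd y w T)) by (intros; ring).
    apply lsum_words_bound; auto using Rabs_pos; try (unfold Rdiv; lra).
    - intros w <-; rewrite Rpow_mult_distr, <- Rmult_assoc.
      now apply (fwd_perturb_bound L); try lra.
    - intros w <-; now apply (fwd_bound_unif L). }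
  assert (B2 : forall e n, Rabs e <= 1 ->
    Rabs (f e n - f 0 n - e * f' n) <= e ^ 2 * (c4 ^ n / INR (fact n))).
  { intros e n He; rewrite <- E0; unfold f, f'.
    rewrite <- lsum_mult_l, <- !lsum_minus, (lsum_ext _ (fun w =>
      (fwd (fun i u => x i u + e * g i u) w T - fwd x w T - e * tangent x g w T) * fwd y w T))
      by (intros; ring).
    apply lsum_words_bound; auto using pow2_ge_0; try lra.
    - intros w <-; rewrite Rpow_mult_distr, <- Rmult_assoc.
      now apply (fwd_taylor_bound L); try lra.
    - intros w <-; now apply (fwd_bound_unif L). }
  assert (Hdiff : forall e, Rabs e <= 1 -> ex_series (fun n => f e n - f 0 n)).
  { intros e He.
    apply (ex_series_le (V := R_CompleteNormedModule) _ (fun n => Rabs e * (c3 ^ n / INR (fact n)))).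
    - intros n; now apply B1.
    - apply (ex_series_scal_l (Rabs e) (fun n => c3 ^ n / INR (fact n))), ex_series_pow_fact. }
  assert (Hrem : forall e, Rabs e <= 1 -> ex_series (fun n => Rabs (f e n - f 0 n - e * f' n))).
  { intros e He.
    apply (ex_series_le (V := R_CompleteNormedModule) _ (fun n => e ^ 2 * (c4 ^ n / INR (fact n)))).
    - intros n; unfold norm; simpl norm; unfold abs; simpl; rewrite Rabs_Rabsolu; now apply B2.
    - apply (ex_series_scal_l (e ^ 2) (fun n => c4 ^ n / INR (fact n))), ex_series_pow_fact. }
  assert (Hf : forall e, Rabs e <= 1 -> ex_series (f e)).
  { intros e He; apply (ex_series_ext (fun n => (f e n - f 0 n) + f 0 n)); [intros n; simpl; ring|].
    apply (ex_series_plus (fun n => f e n - f 0 n) (f 0)); auto. }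
  (* At e = 1 the derivative terms are the increment minus the remainder, and both of these series
     converge. *)
  assert (Hf' : ex_series f').
  { apply (ex_series_ext (fun n => (f 1 n - f 0 n) - (f 1 n - f 0 n - 1 * f' n)));
      [intros n; simpl; ring|].
    assert (H1 : Rabs 1 <= 1) by (rewrite Rabs_R1; lra).
    apply (ex_series_minus (fun n => f 1 n - f 0 n) (fun n => f 1 n - f 0 n - 1 * f' n)); auto.
    now apply ex_series_Rabs, Hrem. }
  set (K := Series (fun n => c4 ^ n / INR (fact n))).
  assert (Hc4 : forall n, 0 <= c4 ^ n / INR (fact n)).
  { intros n; apply Rmult_le_pos; [|apply Rlt_le, Rinv_0_lt_compat, INR_fact_lt_0].
    apply pow_le; unfold c4; repeat apply Rmult_le_pos; auto using pos_INR; lra. }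
  assert (HK : 0 <= K).
  { unfold K; rewrite <- (Rmult_0_l (Series (fun n => c4 ^ n / INR (fact n)))), <- Series_scal_l.
    apply Series_le; [intros n; rewrite Rmult_0_l; split; [lra|auto]|apply ex_series_pow_fact]. }
  assert (B : forall e, Rabs e <= 1 ->
    Rabs (Series (f e) - Series (f 0) - e * Series f') <= e ^ 2 * K).
  { intros e He.
    rewrite <- Series_scal_l, <- !Series_minus by
      (auto; try (now apply Hdiff); now apply (ex_series_scal_l e f')).
    apply Rle_trans with (1 := Series_Rabs _ (Hrem e He)).
    unfold K; rewrite <- Series_scal_l; apply Series_le.
    - intros n; split; [apply Rabs_pos|now apply B2].
    - apply (ex_series_scal_l (e ^ 2) (fun n => c4 ^ n / INR (fact n))), ex_series_pow_fact. }
  (* The empty word has tangent 0, so the series may start at length 1. *)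
  assert (Ef' : Series f' = Series (fun n => f' (S n))).
  { rewrite Series_incr_1 by auto.
    replace (f' O) with 0; [ring|unfold f', lsum; simpl; ring]. }
  change (is_derive (fun e => Series (f e)) 0 (Series (fun n => f' (S n)))); rewrite <- Ef'.
  apply is_derive_Reals; intros eps Heps.
  (* The 1 keeps |h| in the range of the bound [B]; K + 1 avoids dividing by 0 when K = 0. *)
  assert (Hd : 0 < Rmin 1 (eps / (K + 1)))
    by (apply Rmin_glb_lt; [lra|apply Rdiv_lt_0_compat; lra]).
  exists (mkposreal _ Hd); simpl; intros h Hh Hhd; rewrite Rplus_0_l.
  assert (Hh1 : Rabs h <= 1) by (pose proof (Rmin_l 1 (eps / (K + 1))); lra).
  assert (Hh2 : Rabs h < eps / (K + 1)) by (pose proof (Rmin_r 1 (eps / (K + 1))); lra).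
  assert (Hh0 : 0 < Rabs h) by now apply Rabs_pos_lt.
  replace ((Series (f h) - Series (f 0)) / h - Series f') with
    ((Series (f h) - Series (f 0) - h * Series f') / h) by (field; auto).
  unfold Rdiv; rewrite Rabs_mult, Rabs_inv.
  apply Rle_lt_trans with (h ^ 2 * K * / Rabs h).
  - apply Rmult_le_compat_r; [now apply Rlt_le, Rinv_0_lt_compat|now apply B].
  - rewrite <- pow2_abs; replace (Rabs h ^ 2 * K * / Rabs h) with (Rabs h * K) by (field; lra).
    apply Rle_lt_trans with (Rabs h * (K + 1)); [nra|].
    apply Rlt_le_trans with (eps / (K + 1) * (K + 1)); [apply Rmult_lt_compat_r; lra|].
    right; field; lra.
Qed.

End SplitWords.

(** * Velocities of piecewise linear paths *)

Lemma uniform_bound (d : nat) (f : nat -> R -> R) :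
  (forall i, (i < d)%nat -> exists M, forall s, Rabs (f i s) <= M) ->
  exists M, 0 <= M /\ forall i s, (i < d)%nat -> Rabs (f i s) <= M.
Proof.
  induction d as [|d IH]; intros H; [exists 0; split; [lra|intros; lia]|].
  destruct IH as (M & HM & HM'); [intros; apply H; lia|].
  destruct (H d) as (N & HN); [lia|].
  exists (Rmax M N); split; [apply Rle_trans with (2 := Rmax_l M N); auto|].
  intros i s Hi; destruct (Nat.eq_dec i d) as [->|Hn].
  - apply Rle_trans with (2 := Rmax_r M N); auto.
  - apply Rle_trans with (2 := Rmax_l M N); apply HM'; lia.
Qed.

Lemma free_piece (p : nat -> R) (L : list R) (a b : R) (m : nat) :
  a < b -> free L a b -> (forall k, (k <= m)%nat -> In (p k) L) -> p O <= a -> b <= p m ->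
  exists k, (k < m)%nat /\ p k <= a /\ b <= p (S k).
Proof.
  intros Hab F; induction m as [|m IH]; intros HL H0 Hm; [lra|].
  destruct (Rle_dec b (p m)) as [Hb|Hb].
  - destruct IH as (k & Hk & Hk'); auto; exists k; split; auto; lia.
  - exists m; repeat split; auto.
    apply Rnot_lt_le; intros Ha; apply (F (p m)); [apply HL; lia|lra].
Qed.

Lemma point_piece (p : nat -> R) (L : list R) (s : R) (m : nat) :
  ~ In s L -> (forall k, (k <= m)%nat -> In (p k) L) -> p O < s < p m ->
  exists k, (k < m)%nat /\ p k < s < p (S k).
Proof.
  intros HsL; induction m as [|m IH]; intros HL Hs; [lra|].
  destruct (Rtotal_order s (p m)) as [Hm|[->|Hm]].
  - destruct IH as (k & Hk & Hk'); auto; [lra|]; exists k; split; auto; lia.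
  - exfalso; apply HsL, HL; lia.
  - exists m; split; [lia|lra].
Qed.

Lemma is_derive_affine_piece (f : R -> R) (u v a b s : R) :
  (forall r, u <= r <= v -> f r = a + b * r) -> u < s < v -> is_derive f s b.
Proof.
  intros Hf Hs; apply (is_derive_ext_loc (fun r => a + b * r)).
  - apply (locally_interval _ s u v); simpl; try lra.
    intros r Hr1 Hr2; symmetry; apply Hf; lra.
  - auto_derive; auto; ring.
Qed.

(* Cutting the velocity off outside (0,T) makes it piecewise constant on the
   whole line, whatever the path does off [0,T]. *)
Lemma piecewise_linear_velocity (T : R) (d : nat) (Z : path) :
  piecewise_linear T d Z ->
  exists (L : list R) (M : R) (z : nat -> R -> R),
    (forall i, pw_cont L (z i)) /\ (forall i u, Rabs (z i u) <= M) /\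
    (forall i s, (i < d)%nat -> 0 < s < T -> z i s = dot Z i s) /\
    (forall i s, (i < d)%nat -> 0 < s < T -> ~ In s L -> ex_derive (fun r => Z r i) s).
Proof.
  intros (n & p & Hp0 & HpT & Hinc & Haff).
  set (inside := fun s => if Rlt_dec 0 s then if Rlt_dec s T then true else false else false).
  assert (Hin : forall s, 0 < s < T -> inside s = true).
  { intros s Hs; unfold inside; destruct (Rlt_dec 0 s), (Rlt_dec s T); auto; lra. }
  assert (Hout : forall s, inside s = true -> 0 < s < T).
  { intros s; unfold inside; destruct (Rlt_dec 0 s), (Rlt_dec s T); try discriminate; lra. }
  set (z := fun i s => if Nat.ltb i d then if inside s then dot Z i s else 0 else 0).
  assert (Ez : forall i s, (i < d)%nat -> 0 < s < T -> z i s = dot Z i s).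
  { intros i s Hi Hs; unfold z; apply Nat.ltb_lt in Hi; now rewrite Hi, Hin. }
  set (L := map p (List.seq 0 (S n))).
  assert (HL : forall k, (k <= n)%nat -> In (p k) L).
  { intros k Hk; apply in_map, in_seq; lia. }
  destruct (uniform_bound d z) as (M & HM & HzM).
  { intros i Hi.
    assert (B : forall m, (m <= n)%nat -> exists M, 0 <= M /\
      forall s, p O < s < p m -> Rabs (dot Z i s) <= M).
    { induction m as [|m IH]; intros Hm; [exists 0; split; [lra|intros; lra]|].
      destruct IH as (M & HM & HM'); [lia|].
      destruct (Haff m Hm i Hi) as (a & b & Hab).
      (* [M] covers the earlier pieces and [b] is the slope of the new one. At a kink [p m] nothing
         is known about the value of [dot], so that value enters the bound itself. *)
      exists (M + Rabs b + Rabs (dot Z i (p m))).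
      pose proof (Rabs_pos b); pose proof (Rabs_pos (dot Z i (p m))).
      split; [lra|]; intros s Hs; destruct (Rtotal_order s (p m)) as [H1|[->|H1]]; [|lra|].
      - assert (Rabs (dot Z i s) <= M) by (apply HM'; lra); lra.
      - assert (E : dot Z i s = b); [|rewrite E; lra].
        apply is_derive_unique, (is_derive_affine_piece _ (p m) (p (S m)) a); auto; lra. }
    destruct (B n (le_n n)) as (M & HM & HM'); exists M; intros s.
    unfold z; destruct (Nat.ltb i d); [|now rewrite Rabs_R0].
    destruct (inside s) eqn:E; [|now rewrite Rabs_R0].
    apply HM'; rewrite Hp0, HpT; now apply Hout. }
  exists L, M, z; repeat split; auto.
  - intros i a b Hab F.
    assert (Hzero : (forall s, a < s < b -> z i s = 0) ->
      exists h, (forall s, continuous h s) /\ forall s, a < s < b -> z i s = h s).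
    { intros H; exists (fun _ => 0); split; auto.
      intros; apply (continuous_const (V := R_UniformSpace)). }
    destruct (Nat.ltb i d) eqn:Ei.
    2:{ apply Hzero; intros; unfold z; now rewrite Ei. }
    apply Nat.ltb_lt in Ei.
    (* Both 0 and T are breakpoints, so a free interval lies either inside [0,T] or entirely on one
       side of it. *)
    assert (H0 : ~ a < 0 < b) by (rewrite <- Hp0; apply F, HL; lia).
    assert (H1 : ~ a < T < b) by (rewrite <- HpT; apply F, HL; lia).
    assert (Hz0 : forall s, ~ 0 < s < T -> z i s = 0).
    { intros s Hs; unfold z; destruct (inside s) eqn:E; [now apply Hout in E|].
      now destruct (Nat.ltb i d). }
    destruct (Rle_dec b 0) as [Hb|Hb]; [apply Hzero; intros; apply Hz0; lra|].
    destruct (Rle_dec T a) as [Ha|Ha]; [apply Hzero; intros; apply Hz0; lra|].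
    destruct (free_piece p L a b n) as (k & Hk & Hk1 & Hk2); auto; try lra.
    destruct (Haff k Hk i Ei) as (u & v & Huv).
    exists (fun _ => v); split; [intros; apply (continuous_const (V := R_UniformSpace))|].
    intros s Hs; rewrite Ez by (auto; lra); apply is_derive_unique.
    apply (is_derive_affine_piece _ (p k) (p (S k)) u); auto; lra.
  - intros i u; destruct (Nat.ltb i d) eqn:Ei.
    + apply HzM; now apply Nat.ltb_lt.
    + unfold z; rewrite Ei, Rabs_R0; auto.
  - intros i s Hi Hs HsL; destruct (point_piece p L s n) as (k & Hk & Hks); auto; [lra|].
    destruct (Haff k Hk i Hi) as (u & v & Huv); exists v.
    apply (is_derive_affine_piece _ (p k) (p (S k)) u); auto.
Qed.

(** Agreement is required only inside (0,T) and off [L], which is all that the iterated integrals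
    see. *)
Definition velocity_of (T : R) (d : nat) (L : list R) (Z : path) (z : nat -> R -> R) : Prop :=
  (forall i, pw_cont L (z i)) /\
  forall i s, (i < d)%nat -> 0 < s < T -> ~ In s L -> dot Z i s = z i s.

Lemma sig_rev_fwd (T : R) (d : nat) (L : list R) (Z : path) (z : nat -> R -> R)
    (w : list nat) (s : R) :
  velocity_of T d L Z z -> List.Forall (fun i => (i < d)%nat) w -> 0 <= s <= T ->
  sig_rev Z 0 w s = fwd z w s.
Proof.
  intros [Hz Hdot] Hw; revert s; induction Hw as [|i w Hi Hw IH]; intros s Hs; [reflexivity|].
  simpl; apply (RInt_free_ext L); [lra|auto with pw|].
  intros u Hu HL; rewrite IH, Hdot by (auto; lra); reflexivity.
Qed.

Lemma sigker_fwd (T : R) (d : nat) (L L' : list R) (Z W : path) (z y : nat -> R -> R) (s t : R) :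
  velocity_of T d L Z z -> velocity_of T d L' W y -> 0 <= s <= T -> 0 <= t <= T ->
  sigker d Z 0 s W 0 t = Series (fun n => fwd_level d z y n s t).
Proof.
  intros HZ HW Hs Ht; apply Series_ext; intros n; unfold sig.
  change (lsum (fun w => (fun w => sig_rev Z 0 w s * sig_rev W 0 w t) (rev w)) (words d n) =
    fwd_level d z y n s t).
  rewrite lsum_words_rev; apply lsum_ext; intros w Hw; apply in_words in Hw as [_ Hw].
  now rewrite (sig_rev_fwd T d L Z z), (sig_rev_fwd T d L' W y).
Qed.

(** The chain rule needs differentiability as a separate hypothesis, because [dot] has a value even
    where no derivative exists. *)
Lemma velocity_of_rev (T : R) (d : nat) (L : list R) (Z : path) (z : nat -> R -> R) :
  velocity_of T d L Z z ->
  (forall i s, (i < d)%nat -> 0 < s < T -> ~ In s L -> ex_derive (fun r => Z r i) s) ->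
  velocity_of T d (reflect T L) (rev_path T Z) (fun i u => - z i (T - u)).
Proof.
  intros [Hz Hdot] Hex; split.
  - intros i; apply pw_cont_opp; now apply (pw_cont_reflect T L (z i)).
  - intros i s Hi Hs HL.
    assert (HL' : ~ In (T - s) L).
    { intros H; apply HL, in_map_iff; exists (T - s); split; [ring|auto]. }
    rewrite <- Hdot by (auto; lra).
    unfold dot; apply is_derive_unique.
    replace (- Derive (fun r => Z r i) (T - s)) with (scal (-1) (Derive (fun r => Z r i) (T - s)))
      by (unfold scal; simpl; unfold mult; simpl; ring).
    apply (is_derive_comp (fun r => Z r i) (fun r => T - r)).
    + apply Derive_correct, Hex; auto; lra.
    + auto_derive; auto; ring.
Qed.

(** [fwd_opp] extracts (-1)^|w| from each of the two factors, the signs multiply to 1, and [bwd_fwd]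
    identifies what remains. *)
Lemma sigker_rev_bwd (T : R) (d : nat) (L L' : list R) (Z W : path) (z y : nat -> R -> R)
    (s t : R) :
  velocity_of T d (reflect T L) (rev_path T Z) (fun i u => - z i (T - u)) ->
  velocity_of T d (reflect T L') (rev_path T W) (fun i u => - y i (T - u)) ->
  (forall i, pw_cont L (z i)) -> (forall i, pw_cont L' (y i)) ->
  0 <= s <= T -> 0 <= t <= T ->
  sigker d (rev_path T Z) 0 (T - s) (rev_path T W) 0 (T - t) =
  Series (fun n => bwd_level T d z y n s t).
Proof.
  intros HZ HW Hz Hy Hs Ht; rewrite (sigker_fwd T d _ _ _ _ _ _ _ _ HZ HW) by lra.
  apply Series_ext; intros n; apply lsum_ext; intros w _.
  rewrite (fwd_opp (reflect T L) (fun i u => z i (T - u))) by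
    (intros i; now apply (pw_cont_reflect T L (z i))).
  rewrite (fwd_opp (reflect T L') (fun i u => y i (T - u))) by
    (intros i; now apply (pw_cont_reflect T L' (y i))).
  rewrite (bwd_fwd T L z), (bwd_fwd T L' y) by auto.
  replace ((-1) ^ length w * _ * _) with ((-1) ^ length w * (-1) ^ length w *
    (fwd (fun i u => z i (T - u)) w (T - s) * fwd (fun i u => y i (T - u)) w (T - t))) by ring.
  rewrite <- Rpow_mult_distr; replace (-1 * -1) with 1 by ring; rewrite pow1; ring.
Qed.

Theorem theorem4p1 (T : R) (d : nat) (X Y gamma : path) :
  0 < T ->
  piecewise_linear T d X -> piecewise_linear T d Y -> piecewise_linear T d gamma ->
  is_derive
    (fun eps : R => sigker d (fun r i => X r i + eps * gamma r i) 0 T Y 0 T)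
    0
    (RInt (fun t =>
       RInt (fun s =>
         sigker d X 0 s Y 0 t
         * sigker d (rev_path T X) 0 (T - s) (rev_path T Y) 0 (T - t)
         * inner d (fun i => dot gamma i s) (fun i => dot Y i t))
       0 T)
     0 T).
Proof.
  intros HT HX HY HG.
  destruct (piecewise_linear_velocity T d X HX) as (LX & MX & x & Hx & HxM & Ex & Dx).
  destruct (piecewise_linear_velocity T d Y HY) as (LY & MY & y & Hy & HyM & Ey & Dy).
  destruct (piecewise_linear_velocity T d gamma HG) as (LG & MG & g & Hg & HgM & Eg & Dg).
  (* One list of breakpoints and one velocity bound serve all three paths. *)
  set (L := LX ++ LY ++ LG); set (M := Rmax MX (Rmax MY MG)).
  assert (HLX : incl LX L) by apply incl_appl, incl_refl.
  assert (HLY : incl LY L) by apply incl_appr, incl_appl, incl_refl.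
  assert (HLG : incl LG L) by apply incl_appr, incl_appr, incl_refl.
  assert (HMX : MX <= M) by apply Rmax_l.
  assert (HMY : MY <= M) by (apply Rle_trans with (2 := Rmax_r _ _), Rmax_l).
  assert (HMG : MG <= M) by (apply Rle_trans with (2 := Rmax_r _ _), Rmax_r).
  assert (Hx' : forall i, pw_cont L (x i)) by (intros; now apply (pw_cont_incl LX)).
  assert (Hy' : forall i, pw_cont L (y i)) by (intros; now apply (pw_cont_incl LY)).
  assert (Hg' : forall i, pw_cont L (g i)) by (intros; now apply (pw_cont_incl LG)).
  assert (HxM' : forall i u, Rabs (x i u) <= M) by (intros; now apply Rle_trans with MX).
  assert (HyM' : forall i u, Rabs (y i u) <= M) by (intros; now apply Rle_trans with MY).
  assert (HgM' : forall i u, Rabs (g i u) <= M) by (intros; now apply Rle_trans with MG).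
  assert (VX : velocity_of T d L X x) by (split; auto; intros; symmetry; auto).
  assert (VY : velocity_of T d L Y y) by (split; auto; intros; symmetry; auto).
  assert (VRX : velocity_of T d (reflect T L) (rev_path T X) (fun i u => - x i (T - u)))
    by (apply velocity_of_rev; auto).
  assert (VRY : velocity_of T d (reflect T L) (rev_path T Y) (fun i u => - y i (T - u)))
    by (apply velocity_of_rev; auto).
  (* Off [L] both X and gamma are differentiable, so the derivative is linear there. *)
  assert (VE : forall e, velocity_of T d L (fun r i => X r i + e * gamma r i)
    (fun i u => x i u + e * g i u)).
  { intros e; split; [now apply pw_cont_perturb|].
    intros i s Hi Hs HL; rewrite Ex, Eg by auto; unfold dot.
    assert (DX : ex_derive (fun r => X r i) s) by auto.
    assert (DG : ex_derive (fun r => gamma r i) s) by auto.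
    rewrite (Derive_plus (fun r => X r i) (fun r => e * gamma r i)), Derive_scal; auto.
    now apply (ex_derive_scal (fun r => gamma r i)). }
  assert (E : RInt (fun t => RInt (fun s =>
         sigker d X 0 s Y 0 t
         * sigker d (rev_path T X) 0 (T - s) (rev_path T Y) 0 (T - t)
         * inner d (fun i => dot gamma i s) (fun i => dot Y i t)) 0 T) 0 T =
    Series (fun n => lsum (fun w => tangent x g w T * fwd y w T) (words d (S n)))).
  { apply (is_RInt_unique (V := R_CompleteNormedModule)).
    refine (is_RInt_ext _ _ _ _ _ _ (is_RInt_kernels L T M d x g y HT Hx' Hg' Hy' HxM' HgM' HyM')).
    intros t; rewrite Rmin_left, Rmax_right by lra; intros Ht.
    apply (RInt_ext (V := R_CompleteNormedModule)).
    intros s; rewrite Rmin_left, Rmax_right by lra; intros Hs.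
    rewrite (sigker_fwd T d L L X Y x y), (sigker_rev_bwd T d L L X Y x y) by (auto; lra).
    f_equal; apply lsum_ext; intros i Hi; apply in_seq in Hi.
    rewrite Eg, Ey by (auto; lia); reflexivity. }
  rewrite E.
  apply (is_derive_ext (fun e => Series (fun n => fwd_level d (fun i u => x i u + e * g i u) y n T T))).
  - intros e; symmetry; apply (sigker_fwd T d L L); auto; lra.
  - apply (is_derive_fwd_series L T M); auto.
Qed.
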